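(* Let $T_1$ and $T_2$ be non-degenerate $\omega$-Calderón–Zygmund operators on $\mathbb{R}^n$ and $\mathbb{R}^m$, respectively, and let $b$ be a complex-valued locally integrable function on $\mathbb{R}^n\times\mathbb{R}^m$. Suppose that $$\|[T_1,[b,T_2]]\|_{L^2(\mathbb{R}^n\times\mathbb{R}^m)\to L^2(\mathbb{R}^n\times\mathbb{R}^m)}<\infty .$$ Then $b\in\mathrm{BMO}_{\mathrm{rect}}$, i.e. $\|b\|_{\mathrm{BMO}_{\mathrm{rect}}}<\infty$. Moreover, there is a constant $C>0$ independent of $b$ such that $$\|b\|_{\mathrm{BMO}_{\mathrm{rect}}}\le C\,\|[T_1,[b,T_2]]\|_{L^2(\mathbb{R}^n\times\mathbb{R}^m)\to L^2(\mathbb{R}^n\times\mathbb{R}^m)} .$$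
   Context: All functions and kernels may be complex-valued. A rectangle in $\mathbb{R}^n\times\mathbb{R}^m$ is a set $R=I\times J$ with $I\subset\mathbb{R}^n$ and $J\subset\mathbb{R}^m$ cubes; $\langle f\rangle_E=\frac1{|E|}\int_E f$. The rectangular BMO norm is $$\|b\|_{\mathrm{BMO}_{\mathrm{rect}}}=\sup_{R=I\times J}\Big(\frac1{|R|}\int_R\big|b(x,y)-\langle b(\cdot,y)\rangle_I-\langle b(x,\cdot)\rangle_J+\langle b\rangle_R\big|^2\,dx\,dy\Big)^{1/2},$$ the supremum over all rectangles $R=I\times J$. $\omega$-Calderón–Zygmund kernel on $\mathbb{R}^d$: a function $K(x,y)$, $x\neq y$, with $|K(x,y)|\le\frac{C_K}{|x-y|^d}$ for all $x\neq y$ and $$|K(x,y)-K(x',y)|+|K(y,x)-K(y,x')|\le\frac1{|x-y|^d}\,\omega\Big(\frac{|x-x'|}{|x-y|}\Big)\quad\text{whenever }|x-x'|<|x-y|/2,$$ where $\omega:[0,1)\to[0,\infty)$ is increasing. A linear operator $T$ is a non-degenerate $\omega$-Calderón–Zygmund operator on $\mathbb{R}^d$ if it is associated with an $\omega$-Calderón–Zygmund kernel $K$ (i.e. $Tf(x)=\int K(x,y)f(y)\,dy$ for $x\notin\operatorname{supp}f$) with $\omega(t)\to0$ as $t\to0$, and there exists $c_0>0$ such that for every $y\in\mathbb{R}^d$ and $r>0$ there exists $x\in B(y,r)^c$ with $|K(x,y)|\ge\frac1{c_0r^d}$. Bi-commutator: $T_1$ acts on the first variable (in $\mathbb{R}^n$)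 and $T_2$ on the second variable (in $\mathbb{R}^m$) of functions on $\mathbb{R}^n\times\mathbb{R}^m$; $[b,T_2]f=bT_2f-T_2(bf)$ and $[T_1,S]=T_1S-ST_1$. With $K_1,K_2$ the kernels of $T_1,T_2$, this means that for bounded $f$ supported on a rectangle $I\times J$ and for a.e. $(x,y)\in\widetilde I\times\widetilde J$, where $\widetilde I,\widetilde J$ are cubes at positive distance from $I,J$ respectively, $$[T_1,[b,T_2]]f(x,y)=-\int_{I\times J}\big(b(x,y)-b(x,v)-b(u,y)+b(u,v)\big)K_1(x,u)K_2(y,v)f(u,v)\,du\,dv .$$ *)

(* Defs.v *)
From HB Require Import structures.
From mathcomp Require Import all_boot all_order all_algebra.
From mathcomp Require Import all_classical all_reals all_analysis.
From mathcomp Require Import complex.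

Set Implicit Arguments.
Unset Strict Implicit.
Unset Printing Implicit Defensive.

Import Order.TTheory GRing.Theory Num.Theory.
Import numFieldNormedType.Exports.
Import Normc.

Local Open Scope classical_set_scope.
Local Open Scope ring_scope.
Local Open Scope complex_scope.

Definition Rn (R : realType) (n : nat) := n.-tuple (measurableTypeR R).

HB.instance Definition _ (R : realType) (n : nat) :=
  Measurable.on (Rn R n).

(* MathComp-Analysis has no Lebesgue measure on R^n: it is obtained here by
   iterating the binary product measure, R^(n+1) being identified with
   R x R^n through (x, v) |-> x :: v. *)
Section leb_step.
Context {R : realType} (n : nat) (mu : {sigma_finite_measure set Rn R n -> \bar R}).

Definition consRn (p : measurableTypeR R * Rn R n) : Rn R n.+1 :=
  [the n.+1.-tuple (measurableTypeR R) of p.1 :: p.2].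

Lemma measurable_consRn : measurable_fun [set: measurableTypeR R * Rn R n] consRn.
Proof.
apply: (@measurable_cons _ _ _ (measurableTypeR R)).
  exact: measurable_fst.
exact: measurable_snd.
Qed.

HB.instance Definition _ :=
  isMeasurableFun.Build _ _ _ _ consRn measurable_consRn.

Definition leb_step : set (Rn R n.+1) -> \bar R :=
  pushforward (lebesgue_measure \x mu)%E consRn.

Let leb_step0 : leb_step set0 = 0%E.
Proof. exact: measure0. Qed.

Let leb_step_ge0 A : (0 <= leb_step A)%E.
Proof. exact: measure_ge0. Qed.

Let leb_step_sigma_additive : semi_sigma_additive leb_step.
Proof. exact: measure_semi_sigma_additive. Qed.

HB.instance Definition _ := isMeasure.Build _ _ _ leb_step
  leb_step0 leb_step_ge0 leb_step_sigma_additive.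

Let unconsRn (v : Rn R n.+1) : measurableTypeR R * Rn R n :=
  (tnth v ord0, [tuple of behead v]).

Let leb_step_sigma_finite : sigma_finite setT leb_step.
Proof.
pose lebR : {sigma_finite_measure set (measurableTypeR R) -> \bar R} :=
  lebesgue_measure.
have /sigma_finiteP[F [FT ndF Foo]] := sigma_finiteT lebR.
have /sigma_finiteP[G [GT ndG Goo]] := sigma_finiteT mu.
have munconsRn : measurable_fun [set: Rn R n.+1] unconsRn.
  apply: measurable_fun_pair.
    exact: (@measurable_tnth _ (measurableTypeR R)).
  exact: (@measurable_behead _ (measurableTypeR R)).
exists (fun k => unconsRn @^-1` (F k `*` G k)).
  rewrite -preimage_bigcup; apply/esym/seteqP; split=> // v _.
  have [i _ Fi] : (\bigcup_i F i) (unconsRn v).1 by rewrite -FT.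
  have [j _ Gj] : (\bigcup_i G i) (unconsRn v).2 by rewrite -GT.
  exists (maxn i j) => //; split.
    by move: Fi; exact/subsetPset/ndF/leq_maxl.
  by move: Gj; exact/subsetPset/ndG/leq_maxr.
move=> k; have [mF Fk] := Foo k; have [mG Gk] := Goo k; split.
  rewrite -[X in measurable X]setTI; apply: munconsRn => //.
  exact: measurableX.
rewrite /leb_step /pushforward.
have -> : consRn @^-1` (unconsRn @^-1` (F k `*` G k)) = F k `*` G k.
  apply/funext => -[x v]; rewrite /preimage /unconsRn /=.
  by congr (F k _ /\ G k _); exact: val_inj.
by rewrite product_measure1E// lte_mul_pinfty// ge0_fin_numE.
Qed.

HB.instance Definition _ := Measure_isSigmaFinite.Build _ _ _ leb_step
  leb_step_sigma_finite.

End leb_step.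

Fixpoint leb (R : realType) (n : nat) : {sigma_finite_measure set Rn R n -> \bar R} :=
  match n with
  | 0 => dirac ([tuple] : Rn R 0)
  | n'.+1 => leb_step (leb R n')
  end.

Section euclidean.
Context {R : realType}.

Definition edist n (x y : Rn R n) : R :=
  Num.sqrt (\sum_(i < n) (tnth x i - tnth y i) ^+ 2).

Definition cube n (c : Rn R n) (l : R) : set (Rn R n) :=
  [set x | forall i, tnth c i <= tnth x i <= tnth c i + l].

Definition is_cube n (I : set (Rn R n)) : Prop :=
  exists c l, 0 < l /\ I = cube c l.

Definition positive_distance n (I J : set (Rn R n)) : Prop :=
  exists2 delta : R, 0 < delta & forall x y, I x -> J y -> delta <= edist x y.

Definition supp n (f : Rn R n -> R[i]) : set (Rn R n) :=
  [set x | forall e : R, 0 < e -> exists y, edist x y < e /\ f y != 0].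

Definition leb2 n m : {measure set (Rn R n * Rn R m) -> \bar R} :=
  (leb R n \x leb R m)%E.

End euclidean.
Arguments leb2 R n m : clear implicits.

(* Integration of complex-valued functions, through real and imaginary parts;
   [normc : R[i] -> R] is the modulus. *)
Section complex_integral.
Context {R : realType} d (T : measurableType d) (mu : {measure set T -> \bar R}).
Implicit Types (D : set T) (f : T -> R[i]).

Definition cmeasurable D f : Prop :=
  measurable_fun D (fun x => complex.Re (f x)) /\ measurable_fun D (fun x => complex.Im (f x)).

Definition cintegrable D f : Prop :=
  mu.-integrable D (fun x => (complex.Re (f x))%:E) /\
  mu.-integrable D (fun x => (complex.Im (f x))%:E).

Definition cintegral D f : R[i] :=
  (\int[mu]_(x in D) complex.Re (f x)) +i* (\int[mu]_(x in D) complex.Im (f x)).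

Definition cavg D f : R[i] := ((fine (mu D))^-1)%:C * cintegral D f.

Definition L2norm f : \bar R := Lnorm mu 2%:E (fun x => (normc (f x))%:E).

Definition in_L2 f : Prop := cmeasurable setT f /\ (L2norm f < +oo)%E.

End complex_integral.

Section bmo.
Context {R : realType} (n m : nat).
Implicit Types (b : Rn R n * Rn R m -> R[i]).

Definition locally_integrable2 b : Prop :=
  forall I J, is_cube I -> is_cube J -> cintegrable (leb2 R n m) (I `*` J) b.

Definition rect_osc b (I : set (Rn R n)) (J : set (Rn R m)) : \bar R :=
  ((((fine (leb2 R n m (I `*` J)))^-1)%:E *
    \int[leb2 R n m]_(z in I `*` J)
      ((normc (b z - cavg (leb R n) I (fun u => b (u, z.2))
                   - cavg (leb R m) J (fun v => b (z.1, v))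
                   + cavg (leb2 R n m) (I `*` J) b)) ^+ 2)%:E) `^ 2^-1)%E.

Definition BMO_rect_norm b : \bar R :=
  ereal_sup [set rect_osc b I J | I in @is_cube R n & J in @is_cube R m].

End bmo.

Section CZ_operators.
Context {R : realType} (n : nat).
Implicit Types (K : Rn R n -> Rn R n -> R[i]) (omega : R -> R).

Definition CZ_kernel omega K : Prop :=
  (forall t, 0 <= t < 1 -> 0 <= omega t) /\
  (forall s t, 0 <= s -> s <= t -> t < 1 -> omega s <= omega t) /\
  (exists2 CK : R, 0 < CK &
    forall x y, x != y -> normc (K x y) <= CK / edist x y ^+ n) /\
  (forall x x' y, edist x x' < edist x y / 2 ->
    normc (K x y - K x' y) + normc (K y x - K y x') <=
    (edist x y ^+ n)^-1 * omega (edist x x' / edist x y)).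

Definition nondegenerate_kernel K : Prop :=
  exists2 c0 : R, 0 < c0 &
    forall (y : Rn R n) (r : R), 0 < r ->
      exists x, r <= edist x y /\ (c0 * r ^+ n)^-1 <= normc (K x y).

Definition test_fun (f : Rn R n -> R[i]) : Prop :=
  cmeasurable setT f /\
  (exists M : R, forall x, normc (f x) <= M) /\
  (exists2 I, is_cube I & forall x, ~ I x -> f x = 0).

(* A linear operator acts on functions modulo a.e. equality and is defined on
   a linear class of functions which contains at least the bounded functions
   of bounded support; [op_fun] is not constrained outside [op_dom]. *)
Record linear_operator := LinearOperator {
  op_dom : set (Rn R n -> R[i]);
  op_fun :> (Rn R n -> R[i]) -> (Rn R n -> R[i]);
  op_dom_measurable : forall f, op_dom f -> cmeasurable setT f;
  op_dom_test : forall f, test_fun f -> op_dom f;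
  op_dom_linear : forall (a : R[i]) f g, op_dom f -> op_dom g ->
    op_dom (fun x => a * f x + g x);
  op_measurable : forall f, op_dom f -> cmeasurable setT (op_fun f);
  op_linear : forall (a : R[i]) f g, op_dom f -> op_dom g ->
    {ae leb R n, forall x,
      op_fun (fun y => a * f y + g y) x = a * op_fun f x + op_fun g x};
  op_ae : forall f g, op_dom f -> cmeasurable setT g ->
    {ae leb R n, forall x, f x = g x} ->
    op_dom g /\ {ae leb R n, forall x, op_fun f x = op_fun g x}
}.

Definition associated (T : linear_operator) K : Prop :=
  forall f, op_dom T f ->
    {ae leb R n, forall x, ~ supp f x ->
      cintegrable (leb R n) setT (fun y => K x y * f y) ->
      T f x = cintegral (leb R n) setT (fun y => K x y * f y)}.

Definition nondegenerate_CZO (T : linear_operator) K : Prop :=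
  (exists2 omega : R -> R, CZ_kernel omega K & omega t @[t --> 0^'+] --> 0) /\
  associated T K /\ nondegenerate_kernel K.

End CZ_operators.

(* The operators composing the bi-commutator are only partially defined on
   functions of two variables; they are handled through their graphs. *)
Section bicommutator.
Context {R : realType} (n m : nat).
Local Notation F := (Rn R n * Rn R m -> R[i]).
Implicit Types (b f g h : F) (A S : F -> F -> Prop).

Definition on_fst (T1 : linear_operator (R := R) n) f g : Prop :=
  cmeasurable setT f /\ cmeasurable setT g /\
  {ae leb R m, forall y, op_dom T1 (fun u => f (u, y)) /\
    {ae leb R n, forall x, g (x, y) = T1 (fun u => f (u, y)) x}}.

Definition on_snd (T2 : linear_operator (R := R) m) f g : Prop :=
  cmeasurable setT f /\ cmeasurable setT g /\
  {ae leb R n, forall x, op_dom T2 (fun v => f (x, v)) /\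
    {ae leb R m, forall y, g (x, y) = T2 (fun v => f (x, v)) y}}.

Definition mul_commutator b S f h : Prop :=
  exists g1 g2, S f g1 /\ S (fun z => b z * f z) g2 /\
    h = (fun z => b z * g1 z - g2 z).

Definition op_commutator A S f h : Prop :=
  exists g1 g2 h1 h2, S f g1 /\ A g1 h1 /\ A f g2 /\ S g2 h2 /\
    h = (fun z => h1 z - h2 z).

Definition bicommutator_graph (T1 : linear_operator (R := R) n)
    (T2 : linear_operator (R := R) m) b : F -> F -> Prop :=
  op_commutator (on_fst T1) (mul_commutator b (on_snd T2)).

Definition rect_test_fun (I : set (Rn R n)) (J : set (Rn R m)) f : Prop :=
  cmeasurable setT f /\
  (exists M : R, forall z, normc (f z) <= M) /\
  (forall z, ~ (I `*` J) z -> f z = 0).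

(* [B] is the operator [T1, [b, T2]] on L^2. For a merely locally integrable
   [b] the four compositions need not make sense, so [B] is required to agree
   with T1 [b, T2] - [b, T2] T1 wherever the latter is defined, and in all
   cases to have the off-diagonal kernel of the bi-commutator. *)
Record is_bicommutator (T1 : linear_operator (R := R) n)
    (T2 : linear_operator (R := R) m)
    (K1 : Rn R n -> Rn R n -> R[i]) (K2 : Rn R m -> Rn R m -> R[i])
    b (B : F -> F) : Prop := IsBicommutator {
  bicomm_measurable : forall f, in_L2 (leb2 R n m) f -> cmeasurable setT (B f);
  bicomm_linear : forall (a : R[i]) f g,
    in_L2 (leb2 R n m) f -> in_L2 (leb2 R n m) g ->
    {ae leb2 R n m, forall z,
      B (fun w => a * f w + g w) z = a * B f z + B g z};
  bicomm_composition : forall I J f h, is_cube I -> is_cube J ->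
    rect_test_fun I J f -> bicommutator_graph T1 T2 b f h ->
    {ae leb2 R n m, forall z, B f z = h z};
  bicomm_kernel : forall I J I' J' f,
    is_cube I -> is_cube J -> is_cube I' -> is_cube J' ->
    positive_distance I' I -> positive_distance J' J ->
    rect_test_fun I J f ->
    {ae leb2 R n m, forall z, I' z.1 -> J' z.2 ->
      B f z = - cintegral (leb2 R n m) (I `*` J) (fun w =>
        (b z - b (z.1, w.2) - b (w.1, z.2) + b w) *
        K1 z.1 w.1 * K2 z.2 w.2 * f w)}
}.

Definition L2_opnorm (B : F -> F) : \bar R :=
  ereal_sup [set L2norm (leb2 R n m) (B f) | f in
    [set f | in_L2 (leb2 R n m) f /\ (L2norm (leb2 R n m) f <= 1)%E]].

End bicommutator.

(* Main.v *)
(* For a rectangle I x J, nondegeneracy and omega(t) -> 0 give cubes I' and J' of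
   the same sizes, at comparable distances, such that K1 and K2 are within 1/8 of
   a nonzero constant on I' x I and J' x J.  On these cubes the bi-commutator
   controls the form with kernel
     (b(x,y) - b(x,v) - b(u,y) + b(u,v)) k1(x,u) k2(y,v),   |k - 1| <= 1/8,
   for all uniform probability measures, and one may normalise b so that its
   averages over I and over J vanish, which leaves the double difference unchanged.

   One parameter: if the form (c(x) - c(u)) k(x,u) is bounded by N and c has mean
   zero over I, then testing against a phase of c in one variable and 1 in the other
   makes the contribution of k = 1 an L^1 norm of c, and the contribution of k - 1
   is absorbed; no a priori bound on c beyond integrability is needed.  Applying
   this to c(s) = integral of (b(s,y) - b(s,v)) k2(y,v) psi(y) phi(v), and then to
   c(t) = integral of b(s,t) alpha(s), bounds b tested against tensor products
   alpha(s) beta(t) on each of the four rectangles I x J, I' x J, I x J', I' x J'.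

   Two parameters: test the form against 1 on I' x J' and the truncation phi of the
   conjugate of b on I x J.  The term b(u,v) gives the square of the L^2 norm of
   phi up to a factor, and in each of the other three terms two variables can be
   frozen so that b is integrated against a tensor product; the bounds are then
   integrated over the frozen variables by Cauchy-Schwarz. *)
Require Import Defs.
From mathcomp Require Import all_boot all_order all_algebra.
From mathcomp Require Import all_classical all_reals all_analysis.
From mathcomp Require Import complex.
From mathcomp Require Import measurable_realfun ring lra.

Set Implicit Arguments.
Unset Strict Implicit.
Unset Printing Implicit Defensive.

Import Order.TTheory GRing.Theory Num.Theory.
Import numFieldNormedType.Exports.
Import Normc.

Local Open Scope classical_set_scope.
Local Open Scope ring_scope.
Local Open Scope complex_scope.

(** * Complex-valued measurable and integrable functions *)

(** Because [b] is only locally integrable, no L^2 quantity of [b] may be moved to the other side of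
    an inequality before it is known to be finite. Absorption therefore happens only where
    finiteness is free: in L^1 norms of the one-parameter functions [c], and in the L^2 norm of the
    bounded truncation [phi]. The truncation is not a tensor product, so the tensor bound cannot
    reach the term in [b(u,v)]; this is why that term has to be the main one. The tolerance 1/8
    serves twice. The L^1 norms of [c] on the original and on the reflected cube control each other
    with coefficients 1/8 and 9/8, and this loop closes since 1/8 * 9/8 < (7/8)^2. And [k1 k2] stays
    within 1/8 * 9/8 + 1/8 = 17/64 < 1/2 of 1. Constants: each one-parameter estimate costs 4, the
    tensor bound 16 N, a cross term 48 N, the main term 2 (1 + 3 * 48) N = 290 N. With probability
    measures all of this is free of scale; volumes enter once, in the passage from [B] to the form,
    where they cancel against the lower bounds for the kernels and leave [M1 * M2]. *)

Section normc_facts.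
Context {R : realType}.
Implicit Types x y z : R[i].

Lemma normc_ge0 z : 0 <= normc z.
Proof. by case: z => a b; exact: sqrtr_ge0. Qed.

Lemma normcC (r : R) : normc r%:C = `|r|.
Proof. by rewrite /normc/= expr0n addr0 sqrtr_sqr. Qed.

Lemma normcD x y : normc (x + y) <= normc x + normc y.
Proof. exact: (@le_normcD R x y). Qed.

Lemma normc_opp x : normc (- x) = normc x.
Proof. exact: (@normcN R x). Qed.

Lemma normcB x y : normc (x - y) <= normc x + normc y.
Proof. by rewrite -(normc_opp y) normcD. Qed.

Lemma normc_conj x : normc x^*%C = normc x.
Proof. by case: x => a b; rewrite /normc/= sqrrN. Qed.

Lemma normc_sqr x : normc x ^+ 2 = complex.Re x ^+ 2 + complex.Im x ^+ 2.
Proof. by case: x => a b; rewrite /normc/= sqr_sqrtr// addr_ge0 ?sqr_ge0. Qed.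

Lemma mulcJ x : x * x^*%C = (normc x ^+ 2)%:C.
Proof.
rewrite normc_sqr; case: x => a b; apply/eqP; rewrite eq_complex /=.
by apply/andP; split; apply/eqP; ring.
Qed.

Lemma normr_Re x : `|complex.Re x| <= normc x.
Proof.
by rewrite -(ler_pXn2r (ltn0Sn 1)) ?nnegrE ?normc_ge0// real_normK ?num_real//
  normc_sqr lerDl sqr_ge0.
Qed.

Lemma normr_Im x : `|complex.Im x| <= normc x.
Proof.
by rewrite -(ler_pXn2r (ltn0Sn 1)) ?nnegrE ?normc_ge0// real_normK ?num_real//
  normc_sqr lerDr sqr_ge0.
Qed.

Lemma normc_le_ReIm x : normc x <= `|complex.Re x| + `|complex.Im x|.
Proof.
rewrite -(ler_pXn2r (ltn0Sn 1)) ?nnegrE ?normc_ge0 ?addr_ge0//.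
rewrite normc_sqr sqrrD !real_normK ?num_real// addrAC lerDl.
by rewrite mulrn_wge0// mulr_ge0.
Qed.

(** Conjugate phase. At [z = 0] it is 0, the inverse of 0 being 0, so [z * phasec z] is the modulus
    for every [z], and the modulus of [phasec z] is at most 1 rather than equal to 1. *)
Definition phasec z : R[i] := z^*%C / (normc z)%:C.

Lemma normc_phase z : normc (phasec z) <= 1.
Proof.
rewrite /phasec normcM normcV normcC normc_conj ger0_norm ?normc_ge0//.
have [->|z0] := eqVneq (normc z) 0; first by rewrite mul0r.
by rewrite divff.
Qed.

Lemma mul_phasec z : z * phasec z = (normc z)%:C.
Proof.
rewrite /phasec mulrA mulcJ rmorphXn/= expr2.
have [->|z0] := eqVneq (normc z) 0; first by rewrite mul0r mul0r.
by rewrite mulfK// -(rmorph0 (real_complex R)) (inj_eq (@complexI R)).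
Qed.

End normc_facts.

Section cmeasurable.
Context {R : realType} d (T : measurableType d).
Implicit Types f g : T -> R[i].
Local Notation cm := (@cmeasurable R d T setT).

Lemma cmeasurable_cst z : cm (fun=> z).
Proof. by split; exact: measurable_cst. Qed.

Lemma cmeasurableD f g : cm f -> cm g -> cm (fun x => f x + g x).
Proof.
move=> [f1 f2] [g1 g2]; split.
  have -> : (fun x => complex.Re (f x + g x)) =
    (fun x => complex.Re (f x) + complex.Re (g x)).
    by apply/funext => x; case: (f x) (g x) => ? ? [].
  exact: measurable_funD.
have -> : (fun x => complex.Im (f x + g x)) =
  (fun x => complex.Im (f x) + complex.Im (g x)).
  by apply/funext => x; case: (f x) (g x) => ? ? [].
exact: measurable_funD.
Qed.

Lemma cmeasurableM f g : cm f -> cm g -> cm (fun x => f x * g x).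
Proof.
move=> [f1 f2] [g1 g2]; split.
  have -> : (fun x => complex.Re (f x * g x)) = (fun x =>
    complex.Re (f x) * complex.Re (g x) - complex.Im (f x) * complex.Im (g x)).
    by apply/funext => x; case: (f x) (g x) => ? ? [].
  by apply: measurable_funB; exact: measurable_funM.
have -> : (fun x => complex.Im (f x * g x)) = (fun x =>
  complex.Re (f x) * complex.Im (g x) + complex.Im (f x) * complex.Re (g x)).
  by apply/funext => x; case: (f x) (g x) => ? ? [].
by apply: measurable_funD; exact: measurable_funM.
Qed.

Lemma cmeasurable_real (f : T -> R) :
  measurable_fun setT f -> cm (fun x => (f x)%:C).
Proof. by move=> mf; split => //; exact: measurable_cst. Qed.

Lemma cmeasurableN f : cm f -> cm (fun x => - f x).
Proof.
move=> mf; have -> : (fun x => - f x) = (fun x => (-1) * f x).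
  by apply/funext => x; rewrite mulN1r.
by apply: cmeasurableM => //; exact: cmeasurable_cst.
Qed.

Lemma cmeasurableB f g : cm f -> cm g -> cm (fun x => f x - g x).
Proof. by move=> mf mg; apply: cmeasurableD => //; exact: cmeasurableN. Qed.

Lemma cmeasurable_conj f : cm f -> cm (fun x => (f x)^*%C).
Proof.
move=> [f1 f2]; split.
  have -> // : (fun x => complex.Re (f x)^*%C) = (fun x => complex.Re (f x)).
  by apply/funext => x; case: (f x).
have -> : (fun x => complex.Im (f x)^*%C) = (fun x => - complex.Im (f x)).
  by apply/funext => x; case: (f x).
exact: measurableT_comp.
Qed.

Lemma measurable_normc f : cm f -> measurable_fun setT (fun x => normc (f x)).
Proof.
move=> [f1 f2].
have -> : (fun x => normc (f x)) =
  (fun x => (complex.Re (f x) ^+ 2 + complex.Im (f x) ^+ 2) `^ 2^-1).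
  apply/funext => x; rewrite powR12_sqrt ?addr_ge0 ?sqr_ge0//.
  by case: (f x).
apply: (measurableT_comp (measurable_powR _)).
by apply: measurable_funD; exact: measurable_funX.
Qed.

Lemma cmeasurable_phase f : cm f -> cm (fun x => phasec (f x)).
Proof.
move=> mf; apply: cmeasurableM; first exact: cmeasurable_conj.
have -> : (fun x => ((normc (f x))%:C)^-1) = (fun x => ((normc (f x))^-1)%:C).
  by apply/funext => x; rewrite fmorphV.
apply: cmeasurable_real.
have -> : (fun x => (normc (f x))^-1) =
  (fun x => (normc (f x)) `^ (-1)).
  by apply/funext => x; rewrite powR_inv1 ?normc_ge0.
exact: (measurableT_comp (measurable_powR _) (measurable_normc mf)).
Qed.

Lemma cmeasurable_comp d' (T' : measurableType d') (h : T' -> T) f :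
  measurable_fun setT h -> cm f -> cmeasurable setT (fun x => f (h x)).
Proof.
by move=> mh [f1 f2]; split; [exact: (measurableT_comp f1 mh)|
  exact: (measurableT_comp f2 mh)].
Qed.

Lemma cmeasurable_if (p : T -> bool) f g :
  measurable_fun setT p -> cm f -> cm g ->
  cm (fun x => if p x then f x else g x).
Proof.
move=> mp [f1 f2] [g1 g2]; split.
  have -> : (fun x => complex.Re (if p x then f x else g x)) =
    (fun x => if p x then complex.Re (f x) else complex.Re (g x)).
    by apply/funext => x; case: (p x).
  exact: measurable_fun_ifT.
have -> : (fun x => complex.Im (if p x then f x else g x)) =
  (fun x => if p x then complex.Im (f x) else complex.Im (g x)).
  by apply/funext => x; case: (p x).
exact: measurable_fun_ifT.
Qed.

(** Class of the kernels and test functions. The bound holds everywhere, not almost everywhere, so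
    every slice obtained by freezing variables stays in the class, with the same bound. *)
Definition bmeas f := cm f /\ exists M, forall x, normc (f x) <= M.

Lemma bmeas_cst z : bmeas (fun=> z).
Proof. by split; [exact: cmeasurable_cst|exists (normc z)]. Qed.

Lemma bmeasM f g : bmeas f -> bmeas g -> bmeas (fun x => f x * g x).
Proof.
move=> [mf [M fM]] [mg [M' gM]]; split; first exact: cmeasurableM.
exists (M * M') => x; rewrite normcM.
by apply: ler_pM; rewrite ?normc_ge0.
Qed.

Lemma bmeasD f g : bmeas f -> bmeas g -> bmeas (fun x => f x + g x).
Proof.
move=> [mf [M fM]] [mg [M' gM]]; split; first exact: cmeasurableD.
by exists (M + M') => x; apply: (le_trans (normcD _ _)); exact: lerD.
Qed.

Lemma bmeas_phase f : cm f -> bmeas (fun x => phasec (f x)).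
Proof.
move=> mf; split; first exact: cmeasurable_phase.
by exists 1 => x; exact: normc_phase.
Qed.

Lemma bmeas_norm f : bmeas f -> bmeas (fun x => (normc (f x))%:C).
Proof.
move=> [mf [M fM]]; split; first exact/cmeasurable_real/measurable_normc.
by exists M => x; rewrite normcC ger0_norm ?normc_ge0.
Qed.

End cmeasurable.

Lemma bmeas_comp {R : realType} d (T : measurableType d) d'
    (T' : measurableType d') (h : T' -> T) (f : T -> R[i]) :
  measurable_fun setT h -> bmeas f -> bmeas (fun x => f (h x)).
Proof.
move=> mh [mf [M fM]]; split; first exact: cmeasurable_comp.
by exists M => x; exact: fM.
Qed.

Section cintegral.
Context {R : realType} d (T : measurableType d).
Variable mu : {measure set T -> \bar R}.
Implicit Types f g : T -> R[i].
Local Notation cm := (@cmeasurable R d T setT).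
Local Notation ci := (@cintegrable R d T mu setT).
Local Notation Int := (@cintegral R d T mu setT).

Lemma cintegrable_meas f : ci f -> cm f.
Proof.
by move=> [/measurable_int/measurable_EFinP f1 /measurable_int/measurable_EFinP f2].
Qed.

Lemma cintegrable_norm f : ci f -> mu.-integrable setT (EFin \o (fun x => normc (f x))).
Proof.
move=> fi; have [f1 f2] := fi.
have := integrableD measurableT (integrable_abse f1) (integrable_abse f2).
apply: le_integrable => //.
  exact/measurable_EFinP/measurable_normc/cintegrable_meas.
move=> x _ /=; rewrite lee_fin ger0_norm ?normc_ge0//.
by rewrite ger0_norm ?addr_ge0// normc_le_ReIm.
Qed.

Lemma cintegrable_le f (g : T -> R) : cm f -> mu.-integrable setT (EFin \o g) ->
  (forall x, normc (f x) <= g x) -> ci f.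
Proof.
move=> [f1 f2] gi fg; split; apply: (le_integrable measurableT _ _ gi) => //=.
- exact/measurable_EFinP.
- move=> x _ /=; rewrite lee_fin (le_trans (normr_Re _))// (le_trans (fg x))//.
  exact: ler_norm.
- exact/measurable_EFinP.
- move=> x _ /=; rewrite lee_fin (le_trans (normr_Im _))// (le_trans (fg x))//.
  exact: ler_norm.
Qed.

Lemma cintegrable_cle f (g : T -> R[i]) : cm f -> ci g ->
  (forall x, normc (f x) <= normc (g x)) -> ci f.
Proof. by move=> mf /cintegrable_norm gi fg; exact: cintegrable_le gi fg. Qed.

Lemma integrable_le (f g : T -> R) : measurable_fun setT f ->
  mu.-integrable setT (EFin \o g) ->
  (forall x, `|f x| <= g x) -> mu.-integrable setT (EFin \o f).
Proof.
move=> mf gi fg; apply: (le_integrable measurableT _ _ gi) => /=.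
  exact/measurable_EFinP.
by move=> x _; rewrite lee_fin (le_trans (fg x)) ?ler_norm.
Qed.

Lemma cintegrableM f g : ci f -> bmeas g -> ci (fun x => f x * g x).
Proof.
move=> fi [mg [M gM]].
have fi' := integrableZr measurableT M (cintegrable_norm fi).
apply: (cintegrable_le _ fi') => [|x /=].
  by apply: cmeasurableM => //; exact: cintegrable_meas.
by rewrite normcM ler_wpM2l ?normc_ge0.
Qed.

Lemma cintegrableMl f g : ci f -> bmeas g -> ci (fun x => g x * f x).
Proof.
move=> fi gb; have -> : (fun x => g x * f x) = (fun x => f x * g x).
  by apply/funext => x; rewrite mulrC.
exact: cintegrableM.
Qed.

Lemma cintegrableZl f (z : R[i]) : ci f -> ci (fun x => z * f x).
Proof. by move=> fi; apply: cintegrableMl => //; exact: bmeas_cst. Qed.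

Lemma cintegrableD f g : ci f -> ci g -> ci (fun x => f x + g x).
Proof.
move=> fi gi.
have h := integrableD measurableT (cintegrable_norm fi) (cintegrable_norm gi).
apply: (cintegrable_le _ h) => [|x].
  by apply: cmeasurableD; exact: cintegrable_meas.
exact: normcD.
Qed.

Lemma cintegrableN f : ci f -> ci (fun x => - f x).
Proof.
move=> fi; have -> : (fun x => - f x) = (fun x => (-1) * f x).
  by apply/funext => x; rewrite mulN1r.
exact: cintegrableZl.
Qed.

Lemma cintegrableB f g : ci f -> ci g -> ci (fun x => f x - g x).
Proof. by move=> fi gi; apply: cintegrableD => //; exact: cintegrableN. Qed.

Lemma cintegralD f g : ci f -> ci g ->
  Int (fun x => f x + g x) = Int f + Int g.
Proof.
move=> [f1 f2] [g1 g2]; rewrite /cintegral; apply/eqP; rewrite eq_complex /=.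
rewrite -!RintegralD//; apply/andP; split; apply/eqP/eq_Rintegral => x _.
  by case: (f x) (g x) => ? ? [].
by case: (f x) (g x) => ? ? [].
Qed.

Lemma cintegralZl f (z : R[i]) : ci f -> Int (fun x => z * f x) = z * Int f.
Proof.
case: z => a b [f1 f2]; apply/eqP; rewrite eq_complex /=.
have ia1 : mu.-integrable setT (EFin \o (fun x => a * complex.Re (f x))).
  exact: (integrableZl measurableT a f1).
have ia2 : mu.-integrable setT (EFin \o (fun x => a * complex.Im (f x))).
  exact: (integrableZl measurableT a f2).
have ib1 : mu.-integrable setT (EFin \o (fun x => b * complex.Re (f x))).
  exact: (integrableZl measurableT b f1).
have ib2 : mu.-integrable setT (EFin \o (fun x => b * complex.Im (f x))).
  exact: (integrableZl measurableT b f2).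
rewrite -!RintegralZl// -RintegralB// -RintegralD//.
by apply/andP; split; apply/eqP/eq_Rintegral => x _; case: (f x).
Qed.

Lemma cintegralZr f (z : R[i]) : ci f -> Int (fun x => f x * z) = Int f * z.
Proof.
move=> fi; rewrite mulrC -cintegralZl//; congr Int.
by apply/funext => x; rewrite mulrC.
Qed.

Lemma cintegralN f : ci f -> Int (fun x => - f x) = - Int f.
Proof.
move=> fi; rewrite -mulN1r -cintegralZl//; congr Int.
by apply/funext => x; rewrite mulN1r.
Qed.

Lemma cintegralB f g : ci f -> ci g ->
  Int (fun x => f x - g x) = Int f - Int g.
Proof.
by move=> fi gi; rewrite cintegralD ?cintegralN//; exact: cintegrableN.
Qed.

Lemma cintegral_real (g : T -> R) :
  Int (fun x => (g x)%:C) = (\int[mu]_x g x)%:C.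
Proof.
by rewrite /cintegral /= Rintegral_cst// mul0r.
Qed.

(** Rotating the integral by its conjugate phase makes it real, and the real part of the rotated
    integrand is at most [normc (f x)]. *)
Lemma normc_cintegral_le f : ci f -> normc (Int f) <= \int[mu]_x normc (f x).
Proof.
move=> fi; set I := Int f; set e := phasec I.
have eI : (normc I)%:C = Int (fun x => e * f x).
  by rewrite cintegralZl// -/I mulrC mul_phasec.
have -> : normc I = complex.Re (Int (fun x => e * f x)) by rewrite -eI.
rewrite /cintegral /=.
have efi : ci (fun x => e * f x) by exact: cintegrableZl.
apply: le_Rintegral => //.
- by case: efi.
- exact: cintegrable_norm.
move=> x _; apply: le_trans (ler_norm _) _; apply: le_trans (normr_Re _) _.
by rewrite normcM ler_piMl ?normc_ge0// normc_phase.
Qed.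

Lemma normc_cintegral_bound f (g : T -> R) :
  cm f -> mu.-integrable setT (EFin \o g) ->
  (forall x, normc (f x) <= g x) -> normc (Int f) <= \int[mu]_x g x.
Proof.
move=> mf gi fg; have fi := cintegrable_le mf gi fg.
apply: le_trans (normc_cintegral_le fi) _.
by apply: le_Rintegral => //; exact: cintegrable_norm.
Qed.

Lemma cintegral_ae f g : cm f -> cm g -> {ae mu, forall x, f x = g x} ->
  Int f = Int g.
Proof.
move=> [f1 f2] [g1 g2] fg; rewrite /cintegral /Rintegral.
congr (fine _ +i* fine _); apply: ae_eq_integral => //.
- exact/measurable_EFinP.
- exact/measurable_EFinP.
- by apply: filterS fg => x -> _.
- exact/measurable_EFinP.
- exact/measurable_EFinP.
- by apply: filterS fg => x -> _.
Qed.

Lemma integrable_ae_eq (f g : T -> \bar R) : measurable_fun setT g ->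
  mu.-integrable setT f -> {ae mu, forall x, f x = g x} ->
  mu.-integrable setT g.
Proof.
move=> mg /integrableP[mf fi] fg; apply/integrableP; split => //.
rewrite (_ : (\int[mu]_x _ = \int[mu]_x `|f x|)%E)//.
apply: ae_eq_integral => //; [exact: measurableT_comp|exact: measurableT_comp|].
by apply: filterS fg => x -> _.
Qed.

Lemma eq_cintegral f g : f =1 g -> Int f = Int g.
Proof. by move=> fg; congr Int; exact/funext. Qed.

End cintegral.

Section cintegral_probability.
Context {R : realType} d (T : measurableType d) (P : probability T R).
Implicit Types f : T -> R[i].

Lemma integrable_bounded (f : T -> R) M : measurable_fun setT f ->
  (forall x, `|f x| <= M) -> P.-integrable setT (EFin \o f).
Proof.
move=> mf fM.
have := finite_measure_integrable_cst P M measurableT.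
by move/(integrable_le mf); apply.
Qed.

Lemma cintegrable_bmeas f : bmeas f -> cintegrable P setT f.
Proof.
move=> [mf [M fM]].
have := finite_measure_integrable_cst P M measurableT.
by move/(cintegrable_le mf); apply.
Qed.

Lemma Rintegral_prob_cst (r : R) : \int[P]_x r = r.
Proof.
rewrite Rintegral_cst//; have /= -> := probability_setT P.
by rewrite mulr1.
Qed.

Lemma cintegral_prob_cst (z : R[i]) : cintegral P setT (fun=> z) = z.
Proof. by case: z => a b; rewrite /cintegral /= !Rintegral_prob_cst. Qed.

End cintegral_probability.

(** * Measure-preserving maps and Fubini theorems *)

(* Unlike the bare [P \x Q], whose probability structure is not inferred under
   nesting, [pprod] has [probability] as its type. *)
Definition pprod {R : realType} d1 d2 (X : measurableType d1)
  (Y : measurableType d2) (P : probability X R) (Q : probability Y R) :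
  probability (X * Y)%type R := (P \x Q)%E.
Local Notation "P \xx Q" := (pprod P Q) (at level 40, left associativity).

Lemma pprodE {R : realType} d1 d2 (X : measurableType d1) (Y : measurableType d2)
    (P : probability X R) (Q : probability Y R) A B :
  measurable A -> measurable B ->
  ((P \xx Q : {measure set _ -> \bar R}) (A `*` B) =
   (P : {measure set _ -> \bar R}) A * (Q : {measure set _ -> \bar R}) B)%E.
Proof. by move=> mA mB; exact: (product_measure1E P Q). Qed.

Section measure_preserving.
Context {R : realType} d1 d2 (X : measurableType d1) (Y : measurableType d2).
Implicit Types (P : {measure set X -> \bar R}) (Q : {measure set Y -> \bar R}).

Definition mpres P (f : X -> Y) Q := measurable_fun setT f /\
  forall S, measurable S -> P (f @^-1` S) = Q S.

Lemma mpres_integrable P f Q (g : Y -> R) : mpres P f Q ->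
  Q.-integrable setT (EFin \o g) ->
  P.-integrable setT (EFin \o (g \o f)) /\ \int[P]_x g (f x) = \int[Q]_y g y.
Proof.
move=> [mf PQ] /[dup] gi /integrableP[mg goo].
have fi : P.-integrable (f @^-1` setT) ((EFin \o g) \o f).
  apply/integrableP; rewrite preimage_setT; split; first exact: measurableT_comp.
  have mag : measurable_fun setT (abse \o (EFin \o g)) by exact: measurableT_comp.
  have := ge0_integral_pushforward mf P measurableT mag (fun _ _ => abse_ge0 _).
  rewrite (eq_measure_integral Q) => [|S mS _]; last exact: PQ.
  by rewrite preimage_setT => <-.
have := integral_pushforward mf mg fi measurableT.
rewrite (eq_measure_integral Q) => [|S mS _]; last exact: PQ.
rewrite preimage_setT in fi * => e; split => //.
by rewrite /Rintegral e.
Qed.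

Lemma mpres_cintegrable P f Q (g : Y -> R[i]) : mpres P f Q ->
  cintegrable Q setT g -> cintegrable P setT (fun x => g (f x)).
Proof.
move=> pf [g1 g2]; split.
  by have [] := mpres_integrable pf g1.
by have [] := mpres_integrable pf g2.
Qed.

Lemma mpres_cintegral P f Q (g : Y -> R[i]) : mpres P f Q ->
  cintegrable Q setT g ->
  cintegral P setT (fun x => g (f x)) = cintegral Q setT g.
Proof.
move=> pf [g1 g2]; rewrite /cintegral.
have [_ ->] := mpres_integrable pf g1.
by have [_ ->] := mpres_integrable pf g2.
Qed.

End measure_preserving.

Section measure_preserving_maps.
Context {R : realType}.

Lemma mpres_id d (X : measurableType d) (P : {measure set X -> \bar R}) :
  mpres P id P.
Proof. by split. Qed.

Lemma mpres_comp d1 d2 d3 (X : measurableType d1) (Y : measurableType d2)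
    (Z : measurableType d3) (P : {measure set X -> \bar R})
    (Q : {measure set Y -> \bar R}) (S : {measure set Z -> \bar R}) f g :
  mpres P f Q -> mpres Q g S -> mpres P (g \o f) S.
Proof.
move=> [mf PQ] [mg QS]; split; first exact: measurableT_comp.
move=> A mA; rewrite comp_preimage PQ ?QS//.
by rewrite -[X in measurable X]setTI; exact: mg.
Qed.

Context d1 d2 (X : measurableType d1) (Y : measurableType d2).
Variables (P : probability X R) (Q : probability Y R).

(** A measure with the right values on measurable rectangles is the product measure; this is applied
    to the pushforward of [m] by [h]. *)
Lemma mpres_rect d (T : measurableType d) (m : {measure set T -> \bar R}) h :
  measurable_fun setT h ->
  (forall A B, measurable A -> measurable B ->
    m (h @^-1` (A `*` B)) =
    (P : {measure set _ -> \bar R}) A * (Q : {measure set _ -> \bar R}) B)%E ->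
  mpres m h (P \xx Q).
Proof.
move=> mh mhAB; split => // S mS; apply/esym.
exact: (@product_measure_unique _ _ _ _ _ P Q
  (measure_function_pushforward__canonical__measure_function_Measure m mh)).
Qed.

Lemma mpres_fst : mpres (P \xx Q) fst P.
Proof.
split => [|S mS]; first exact: measurable_fst.
have -> : fst @^-1` S = S `*` [set: Y] by apply/seteqP; split => // -[x y] [].
rewrite pprodE//.
by have /= -> := probability_setT Q; rewrite mule1.
Qed.

Lemma mpres_snd : mpres (P \xx Q) snd Q.
Proof.
split => [|S mS]; first exact: measurable_snd.
have -> : snd @^-1` S = [set: X] `*` S by apply/seteqP; split => // -[x y] [].
rewrite pprodE//.
by have /= -> := probability_setT P; rewrite mul1e.
Qed.

End measure_preserving_maps.

Section measure_preserving_products.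
Context {R : realType} d1 d2 d3 d4 (X : measurableType d1) (Y : measurableType d2)
  (X' : measurableType d3) (Y' : measurableType d4).
Variables (P : probability X R) (Q : probability Y R).
Variables (P' : probability X' R) (Q' : probability Y' R).

Lemma mpres_swap : mpres (P \xx Q) (fun z => (z.2, z.1)) (Q \xx P).
Proof.
apply: mpres_rect => [|A B mA mB].
  by apply: measurable_fun_pair => /=; [exact: measurable_snd|exact: measurable_fst].
have -> : (fun z => (z.2, z.1)) @^-1` (A `*` B) = B `*` A.
  by apply/seteqP; split => -[x y] [].
by rewrite pprodE// muleC.
Qed.

Lemma mpres_prod f g : mpres P f P' -> mpres Q g Q' ->
  mpres (P \xx Q) (fun z => (f z.1, g z.2)) (P' \xx Q').
Proof.
move=> [mf PP'] [mg QQ']; apply: mpres_rect => [|A B mA mB].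
  apply: measurable_fun_pair => /=.
    by apply: (measurableT_comp mf); exact: measurable_fst.
  by apply: (measurableT_comp mg); exact: measurable_snd.
have -> : (fun z => (f z.1, g z.2)) @^-1` (A `*` B) = (f @^-1` A) `*` (g @^-1` B).
  by apply/seteqP; split => -[x y] [].
rewrite pprodE ?PP' ?QQ'//.
  by rewrite -[X in measurable X]setTI; exact: mf.
by rewrite -[X in measurable X]setTI; exact: mg.
Qed.

(** Regroups from points, [(x, y)] and [(u, v)], to parameters, [(x, u)] and [(y, v)]: the
    bi-commutator integrates over the former, [k1] and [k2] depend on the latter. *)
Definition transpose4 (z : (X * Y) * (X' * Y')) : (X * X') * (Y * Y') :=
  ((z.1.1, z.2.1), (z.1.2, z.2.2)).

Lemma mpres_transpose4 :
  mpres ((P \xx Q) \xx (P' \xx Q')) transpose4 ((P \xx P') \xx (Q \xx Q')).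
Proof.
apply: mpres_rect => [|A B mA mB].
  apply: measurable_fun_pair; apply: measurable_fun_pair => /=.
  - exact: (measurableT_comp measurable_fst measurable_fst).
  - exact: (measurableT_comp measurable_fst measurable_snd).
  - exact: (measurableT_comp measurable_snd measurable_fst).
  - exact: (measurableT_comp measurable_snd measurable_snd).
(* The section over [(x, y)] of the preimage is the rectangle of the sections of [A] at [x] and of
   [B] at [y], so its measure is a function of [x] times a function of [y], and Tonelli separates
   them. *)
transitivity (\int[P \xx Q]_z
    (P' (xsection A z.1) * Q' (xsection B z.2)))%E.
  apply: eq_integral => z _ /=.
  have -> : xsection (transpose4 @^-1` (A `*` B)) z =
      xsection A z.1 `*` xsection B z.2.
    by apply/seteqP; split => -[u v]; rewrite /xsection /= !inE.
  by apply: (pprodE P' Q'); exact: measurable_xsection.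
have mA' := measurable_fun_xsection P' mA.
have mB' := measurable_fun_xsection Q' mB.
apply: etrans (fubini_tonelli1 (m1 := P) (m2 := Q)
  (fun z => P' (xsection A z.1) * Q' (xsection B z.2))%E _ _) _; last first.
- rewrite /fubini_F /=.
  under eq_integral => x _ do rewrite ge0_integralZl//.
  by rewrite ge0_integralZr ?integral_ge0.
- by move=> z; rewrite mule_ge0.
- apply: emeasurable_funM.
    exact: (measurableT_comp mA' measurable_fst).
  exact: (measurableT_comp mB' measurable_snd).
Qed.

End measure_preserving_products.

Section fubini.
Context {R : realType} d1 d2 (X : measurableType d1) (Y : measurableType d2).
Variables (P : probability X R) (Q : probability Y R).

Lemma Rfubini (f : X * Y -> R) : (P \xx Q).-integrable setT (EFin \o f) ->
  P.-integrable setT (EFin \o (fun x => \int[Q]_y f (x, y))) /\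
  \int[P]_x \int[Q]_y f (x, y) = \int[(P \xx Q)]_z f z.
Proof.
move=> fi; have Fi := integrable_fubini_F fi.
have mF : measurable_fun setT (fun x => \int[Q]_y f (x, y)).
  apply: (measurableT_comp (fine_measurable measurableT)).
  exact: (measurable_int _ Fi).
(* The real-valued inner integral is [fine] of the extended one; the two differ only where the
   latter is infinite, which is a null set. *)
have F_ae : {ae P, forall x, fubini_F Q (EFin \o f) x = (\int[Q]_y f (x, y))%:E}.
  have := integrable_ae measurableT Fi; apply: filterS => x /(_ I) Fx.
  by rewrite -(fineK Fx).
split.
  by apply: (integrable_ae_eq _ Fi F_ae); exact/measurable_EFinP.
rewrite [RHS]/Rintegral -integral12_prod_meas1//; congr fine.
apply/esym; apply: ae_eq_integral => //.
- exact: (measurable_int _ Fi).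
- exact/measurable_EFinP.
- by apply: filterS F_ae.
Qed.

Lemma cfubini_integrable (f : X * Y -> R[i]) : cintegrable (P \xx Q) setT f ->
  cintegrable P setT (fun x => cintegral Q setT (fun y => f (x, y))).
Proof.
move=> [f1 f2]; split.
  by have [] := Rfubini f1.
by have [] := Rfubini f2.
Qed.

Lemma cfubini (f : X * Y -> R[i]) : cintegrable (P \xx Q) setT f ->
  cintegral (P \xx Q) setT f =
  cintegral P setT (fun x => cintegral Q setT (fun y => f (x, y))).
Proof.
move=> [f1 f2]; rewrite /cintegral /=.
have [_ ->] := Rfubini f1.
by have [_ ->] := Rfubini f2.
Qed.

Lemma ae_cintegrable (f : X * Y -> R[i]) : cintegrable (P \xx Q) setT f ->
  {ae P, forall x, cintegrable Q setT (fun y => f (x, y))}.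
Proof.
move=> [f1 f2]; have := ae_integrable1 f1; have := ae_integrable1 f2.
by apply: filterS2 => x.
Qed.

End fubini.

(** * The one-parameter estimate *)

Section bounded_products.
Context {R : realType} d1 d2 (X : measurableType d1) (Y : measurableType d2).
Variables (P : probability X R) (Q : probability Y R).

Lemma cintegrable_fst (f : X -> R[i]) : cintegrable P setT f ->
  cintegrable (P \xx Q) setT (fun z => f z.1).
Proof. by move=> fi; exact: (mpres_cintegrable (mpres_fst P Q) fi). Qed.

Lemma cintegrable_snd (g : Y -> R[i]) : cintegrable Q setT g ->
  cintegrable (P \xx Q) setT (fun z => g z.2).
Proof. by move=> fi; exact: (mpres_cintegrable (mpres_snd P Q) fi). Qed.

Lemma bmeas_fst (f : X -> R[i]) : bmeas f -> bmeas (fun z : X * Y => f z.1).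
Proof. exact: bmeas_comp measurable_fst. Qed.

Lemma bmeas_snd (g : Y -> R[i]) : bmeas g -> bmeas (fun z : X * Y => g z.2).
Proof. exact: bmeas_comp measurable_snd. Qed.

Lemma cintegral_prodl (f : X -> R[i]) (g : Y -> R[i]) :
  cintegrable P setT f -> bmeas g ->
  cintegral (P \xx Q) setT (fun z => f z.1 * g z.2) =
  cintegral P setT f * cintegral Q setT g.
Proof.
move=> fi gb; rewrite cfubini/=; last first.
  by apply: cintegrableM; [exact: cintegrable_fst|exact: bmeas_snd].
rewrite -cintegralZr//; apply: eq_cintegral => x.
by rewrite cintegralZl//; exact: cintegrable_bmeas.
Qed.

Lemma cintegral_prodr (f : X -> R[i]) (g : Y -> R[i]) :
  bmeas f -> cintegrable Q setT g ->
  cintegral (P \xx Q) setT (fun z => f z.1 * g z.2) =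
  cintegral P setT f * cintegral Q setT g.
Proof.
move=> fb gi; rewrite cfubini/=; last first.
  by apply: cintegrableMl; [exact: cintegrable_snd|exact: bmeas_fst].
rewrite -cintegralZr//; last exact: cintegrable_bmeas.
by apply: eq_cintegral => x; rewrite cintegralZl.
Qed.

Lemma Rintegral_norm_fst (f : X -> R[i]) : cintegrable P setT f ->
  \int[P \xx Q]_z normc (f z.1) = \int[P]_x normc (f x).
Proof.
by move=> /cintegrable_norm fi; have [_] := mpres_integrable (mpres_fst P Q) fi.
Qed.

Lemma Rintegral_norm_snd (f : Y -> R[i]) : cintegrable Q setT f ->
  \int[P \xx Q]_z normc (f z.2) = \int[Q]_x normc (f x).
Proof.
by move=> /cintegrable_norm fi; have [_] := mpres_integrable (mpres_snd P Q) fi.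
Qed.

End bounded_products.

Section norm_real.
Context {R : realType} d (T : measurableType d) (P : probability T R).
Implicit Types f g : T -> R[i].

Lemma cintegrable_norm_real f : cintegrable P setT f ->
  cintegrable P setT (fun x => (normc (f x))%:C).
Proof.
move=> fi; apply: (cintegrable_cle _ fi) => [|x].
  exact/cmeasurable_real/measurable_normc/cintegrable_meas/fi.
by rewrite normcC ger0_norm ?normc_ge0.
Qed.

(** Squared L^2 norm as a real number. It measures bounded test functions; functions whose square
    integral may diverge, such as [b] or [B f], are handled with the extended integral. *)
Definition sqint f : R := \int[P]_x (normc (f x) ^+ 2).

Lemma integrable_sq f : bmeas f ->
  P.-integrable setT (EFin \o (fun x => normc (f x) ^+ 2)).
Proof.
move=> [mf [M fM]]; apply: (@integrable_bounded _ _ _ _ _ (M ^+ 2)).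
  exact/measurable_funX/measurable_normc.
by move=> x; rewrite ger0_norm ?sqr_ge0// lerXn2r ?nnegrE ?normc_ge0//
  (le_trans _ (fM x)) ?normc_ge0.
Qed.

Lemma sqint_ge0 f : 0 <= sqint f.
Proof. by apply: Rintegral_ge0 => x _; exact: sqr_ge0. Qed.

Lemma sqint_le f g : bmeas f -> bmeas g ->
  (forall x, normc (f x) <= normc (g x)) -> sqint f <= sqint g.
Proof.
move=> fb gb fg; apply: le_Rintegral => //; try exact: integrable_sq.
by move=> x _; rewrite lerXn2r ?nnegrE ?normc_ge0.
Qed.

Lemma sqint_le_bound f (M : R) : bmeas f -> (forall x, normc (f x) <= M) ->
  sqint f <= M ^+ 2.
Proof.
move=> fb fM; rewrite -[leRHS](Rintegral_prob_cst P).
apply: le_Rintegral => //; first exact: integrable_sq.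
  exact: finite_measure_integrable_cst.
by move=> x _; rewrite lerXn2r ?nnegrE ?normc_ge0// (le_trans _ (fM x)) ?normc_ge0.
Qed.

(** Integrates [|f| |g| <= (e/2a) |f|^2 + (a/2e) |g|^2], which gives [ae/2 + ae/2]. Positive upper
    bounds [a] and [e] in place of the norms avoid square roots and the case of a vanishing norm. *)
Lemma cauchy_schwarz f g a e : bmeas f -> bmeas g -> 0 < a -> 0 < e ->
  sqint f <= a ^+ 2 -> sqint g <= e ^+ 2 ->
  \int[P]_x (normc (f x) * normc (g x)) <= a * e.
Proof.
move=> fb gb a0 e0 fa ge.
have fi : P.-integrable setT (EFin \o (fun x => e / a / 2 * normc (f x) ^+ 2)).
  exact: (integrableZl measurableT (e / a / 2) (integrable_sq fb)).
have gi : P.-integrable setT (EFin \o (fun x => a / e / 2 * normc (g x) ^+ 2)).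
  exact: (integrableZl measurableT (a / e / 2) (integrable_sq gb)).
have fgi := integrableD measurableT fi gi.
have le1 x : normc (f x) * normc (g x) <=
    e / a / 2 * normc (f x) ^+ 2 + a / e / 2 * normc (g x) ^+ 2.
  rewrite -subr_ge0.
  have -> : e / a / 2 * normc (f x) ^+ 2 + a / e / 2 * normc (g x) ^+ 2 -
      normc (f x) * normc (g x) =
      (e * normc (f x) - a * normc (g x)) ^+ 2 / (a * e * 2).
    by field; rewrite !gt_eqF.
  by rewrite divr_ge0 ?sqr_ge0// ltW// !mulr_gt0.
have h : \int[P]_x (normc (f x) * normc (g x)) <=
    \int[P]_x (e / a / 2 * normc (f x) ^+ 2 + a / e / 2 * normc (g x) ^+ 2).
  apply: le_Rintegral => //.
  apply: integrable_le fgi _ => [|x].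
    by apply: measurable_funM; apply: measurable_normc; [case: fb|case: gb].
  by rewrite ger0_norm ?mulr_ge0 ?normc_ge0.
apply: (le_trans h); rewrite RintegralD//.
rewrite RintegralZl//; last exact: integrable_sq.
rewrite RintegralZl//; last exact: integrable_sq.
rewrite -/(sqint f) -/(sqint g).
have -> : a * e = e / a / 2 * a ^+ 2 + a / e / 2 * e ^+ 2.
  by field; rewrite !gt_eqF.
by apply: lerD; rewrite ler_wpM2l// ltW// !divr_gt0.
Qed.

Lemma norm1_le f a : bmeas f -> 0 < a -> sqint f <= a ^+ 2 ->
  \int[P]_x normc (f x) <= a.
Proof.
move=> fb a0 fa.
have := @cauchy_schwarz f (fun=> 1) a 1 fb (bmeas_cst _ _) a0 ltr01 fa.
rewrite normc1 mulr1 => h.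
have <- : \int[P]_x (normc (f x) * 1) = \int[P]_x normc (f x).
  by apply: eq_Rintegral => x _; rewrite mulr1.
by apply: h; apply: sqint_le_bound; [exact: bmeas_cst|move=> x; rewrite normc1].
Qed.

End norm_real.

Lemma normc_near1 {R : realType} (z : R[i]) :
  normc (z - 1) <= 8^-1 -> normc z <= 9 / 8.
Proof.
move=> z1; have -> : z = 1 + (z - 1) by ring.
by apply: le_trans (normcD _ _) _; rewrite normc1; lra.
Qed.

Lemma bmeas_near1 {R : realType} d (T : measurableType d) (k : T -> R[i]) :
  cmeasurable setT k -> (forall z, normc (k z - 1) <= 8^-1) -> bmeas k.
Proof. by move=> mk k1; split => //; exists (9 / 8) => z; exact: normc_near1. Qed.

Section one_parameter.
Context {R : realType} d (T : measurableType d) (P0 P1 : probability T R).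
Variables (c : T -> R[i]) (k : T * T -> R[i]) (N : R).
Hypotheses (ci0 : cintegrable P0 setT c) (ci1 : cintegrable P1 setT c).
Hypothesis c0 : cintegral P0 setT c = 0.
Hypotheses (mk : cmeasurable setT k) (k1 : forall z, normc (k z - 1) <= 8^-1).
Hypothesis N0 : 0 <= N.
Hypothesis H : forall phi psi a e, bmeas phi -> bmeas psi -> 0 < a -> 0 < e ->
  sqint P0 phi <= a ^+ 2 -> sqint P1 psi <= e ^+ 2 ->
  normc (cintegral (P1 \xx P0) setT (fun z =>
    (c z.1 - c z.2) * k z * psi z.1 * phi z.2)) <= N * a * e.

Local Notation W := (P1 \xx P0).

Let kb : bmeas k := bmeas_near1 mk k1.

Let k1b : bmeas (fun z => k z - 1).
Proof. by apply: bmeasD => //; exact: bmeas_cst. Qed.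

(* As [c psi >= 0] and [c] has mean zero for [P0], replacing [k] by [1] in the
   form turns it into the integral of [|c psi|]. *)
Let one_parameter_psi psi e : bmeas psi -> 0 < e -> sqint P1 psi <= e ^+ 2 ->
  (forall x, c x * psi x = (normc (c x * psi x))%:C) ->
  7 / 8 * \int[P1]_x normc (c x * psi x) <=
  N * e + 8^-1 * (\int[P0]_x normc (c x) * e).
Proof.
move=> pb e0 pe cpsi.
have cpi : cintegrable P1 setT (fun x => c x * psi x) by exact: cintegrableM.
have cpW := cintegrable_fst P0 cpi.
have c2W : cintegrable W setT (fun z => c z.2 * psi z.1).
  by apply: cintegrableM; [exact: cintegrable_snd|exact: bmeas_fst].
have E1W := cintegrableM cpW k1b.
have E2W := cintegrableM c2W k1b.
have := @H (fun=> 1) psi 1 e (bmeas_cst _ _) pb ltr01 e0 _ pe.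
have -> : sqint P0 (fun=> 1) <= 1 ^+ 2.
  by apply: sqint_le_bound; [exact: bmeas_cst|move=> x; rewrite normc1].
move=> /(_ isT).
set F := cintegral _ _ _ => HF.
have FE : (\int[P1]_x normc (c x * psi x))%:C = F
    - cintegral W setT (fun z => c z.1 * psi z.1 * (k z - 1))
    + cintegral W setT (fun z => c z.2 * psi z.1 * (k z - 1)).
  have -> : F = cintegral W setT (fun z => c z.1 * psi z.1)
      + cintegral W setT (fun z => c z.1 * psi z.1 * (k z - 1))
      - cintegral W setT (fun z => c z.2 * psi z.1)
      - cintegral W setT (fun z => c z.2 * psi z.1 * (k z - 1)).
    rewrite -cintegralD// -cintegralB//; last exact: cintegrableD.
    rewrite -cintegralB//; last by apply: cintegrableB => //; exact: cintegrableD.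
    by apply: eq_cintegral => z; ring.
  have -> : cintegral W setT (fun z => c z.2 * psi z.1) = 0.
    under [X in cintegral _ _ X]funext do rewrite mulrC.
    by rewrite cintegral_prodr// c0 mulr0.
  rewrite (mpres_cintegral (mpres_fst P1 P0) cpi).
  rewrite -cintegral_real (_ : cintegral P1 setT _ = cintegral P1 setT
    (fun x => c x * psi x)); first by ring.
  by apply: eq_cintegral => x; rewrite -cpsi.
have E1 : normc (cintegral W setT (fun z => c z.1 * psi z.1 * (k z - 1))) <=
    8^-1 * \int[P1]_x normc (c x * psi x).
  rewrite -(Rintegral_norm_fst P0 cpi) -RintegralZl//; last exact: cintegrable_norm.
  apply: normc_cintegral_bound; first exact: cintegrable_meas E1W.
    exact: (integrableZl measurableT _ (cintegrable_norm cpW)).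
  by move=> z; rewrite normcM mulrC ler_wpM2r ?normc_ge0.
have E2 : normc (cintegral W setT (fun z => c z.2 * psi z.1 * (k z - 1))) <=
    8^-1 * (\int[P0]_x normc (c x) * e).
  have h : \int[W]_z normc (c z.2 * psi z.1) <= \int[P0]_x normc (c x) * e.
    apply: (@le_trans _ _ (\int[P0]_x normc (c x) * \int[P1]_x normc (psi x))).
      rewrite -lecR rmorphM/= -!cintegral_real mulrC -cintegral_prodr//.
      - rewrite (_ : cintegral _ _ _ = cintegral W setT (fun z =>
          (normc (psi z.1))%:C * (normc (c z.2))%:C))//.
        by apply: eq_cintegral => z; rewrite normcM mulrC rmorphM.
      - exact: bmeas_norm.
      - exact: cintegrable_norm_real.
    rewrite ler_wpM2l ?(norm1_le pb)//.
    by apply: Rintegral_ge0 => x _; exact: normc_ge0.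
  apply: le_trans (_ : 8^-1 * \int[W]_z normc (c z.2 * psi z.1) <= _); last first.
    by rewrite ler_wpM2l.
  rewrite -RintegralZl//; last exact: cintegrable_norm.
  apply: normc_cintegral_bound; first exact: cintegrable_meas E2W.
    exact: (integrableZl measurableT _ (cintegrable_norm c2W)).
  by move=> z; rewrite normcM mulrC ler_wpM2r ?normc_ge0.
have : normc (\int[P1]_x normc (c x * psi x))%:C <= N * e
    + 8^-1 * \int[P1]_x normc (c x * psi x)
    + 8^-1 * (\int[P0]_x normc (c x) * e).
  rewrite FE; apply: le_trans (normcD _ _) _; apply: lerD => //.
  apply: le_trans (normcB _ _) _; apply: lerD => //.
  by rewrite -(mulr1 N).
rewrite normcC ger0_norm; first lra.
by apply: Rintegral_ge0 => x _; exact: normc_ge0.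
Qed.

(** Now [c(u)] is the main term. The mean of [c] over [P1] is not controlled, so the term in [c(x)]
    keeps all of [k] and costs 9/8 instead of 1/8. *)
Let one_parameter_phi phi a : bmeas phi -> 0 < a -> sqint P0 phi <= a ^+ 2 ->
  (forall x, c x * phi x = (normc (c x * phi x))%:C) ->
  7 / 8 * \int[P0]_x normc (c x * phi x) <=
  N * a + 9 / 8 * (\int[P1]_x normc (c x) * a).
Proof.
move=> pb a0 pa cphi.
have cpi : cintegrable P0 setT (fun x => c x * phi x) by exact: cintegrableM.
have cpW := cintegrable_snd P1 cpi.
have c1W : cintegrable W setT (fun z => c z.1 * phi z.2).
  by apply: cintegrableM; [exact: cintegrable_fst|exact: bmeas_snd].
have E1W := cintegrableM cpW k1b.
have E2W := cintegrableM c1W kb.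
have := @H phi (fun=> 1) a 1 pb (bmeas_cst _ _) a0 ltr01 pa _.
have -> : sqint P1 (fun=> 1) <= 1 ^+ 2.
  by apply: sqint_le_bound; [exact: bmeas_cst|move=> x; rewrite normc1].
move=> /(_ isT).
set F := cintegral _ _ _ => HF.
have FE : (\int[P0]_x normc (c x * phi x))%:C = - F
    - cintegral W setT (fun z => c z.2 * phi z.2 * (k z - 1))
    + cintegral W setT (fun z => c z.1 * phi z.2 * k z).
  have -> : F = cintegral W setT (fun z => c z.1 * phi z.2 * k z)
      - cintegral W setT (fun z => c z.2 * phi z.2 * (k z - 1))
      - cintegral W setT (fun z => c z.2 * phi z.2).
    rewrite -cintegralB// -cintegralB//; last exact: cintegrableB.
    by apply: eq_cintegral => z; ring.
  rewrite (mpres_cintegral (mpres_snd P1 P0) cpi).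
  rewrite -cintegral_real (_ : cintegral P0 setT _ = cintegral P0 setT
    (fun x => c x * phi x)); first by ring.
  by apply: eq_cintegral => x; rewrite -cphi.
have E1 : normc (cintegral W setT (fun z => c z.2 * phi z.2 * (k z - 1))) <=
    8^-1 * \int[P0]_x normc (c x * phi x).
  rewrite -(Rintegral_norm_snd P1 cpi) -RintegralZl//; last exact: cintegrable_norm.
  apply: normc_cintegral_bound; first exact: cintegrable_meas E1W.
    exact: (integrableZl measurableT _ (cintegrable_norm cpW)).
  by move=> z; rewrite normcM mulrC ler_wpM2r ?normc_ge0.
have E2 : normc (cintegral W setT (fun z => c z.1 * phi z.2 * k z)) <=
    9 / 8 * (\int[P1]_x normc (c x) * a).
  have h : \int[W]_z normc (c z.1 * phi z.2) <= \int[P1]_x normc (c x) * a.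
    apply: (@le_trans _ _ (\int[P1]_x normc (c x) * \int[P0]_x normc (phi x))).
      rewrite -lecR rmorphM/= -!cintegral_real -cintegral_prodl//.
      - rewrite (_ : cintegral _ _ _ = cintegral W setT (fun z =>
          (normc (c z.1))%:C * (normc (phi z.2))%:C))//.
        by apply: eq_cintegral => z; rewrite normcM rmorphM.
      - exact: cintegrable_norm_real.
      - exact: bmeas_norm.
    rewrite ler_wpM2l ?(norm1_le pb)//.
    by apply: Rintegral_ge0 => x _; exact: normc_ge0.
  apply: le_trans (_ : 9 / 8 * \int[W]_z normc (c z.1 * phi z.2) <= _); last first.
    by rewrite ler_wpM2l.
  rewrite -RintegralZl//; last exact: cintegrable_norm.
  apply: normc_cintegral_bound; first exact: cintegrable_meas E2W.
    exact: (integrableZl measurableT _ (cintegrable_norm c1W)).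
  move=> z; rewrite normcM mulrC ler_wpM2r ?normc_ge0//.
  exact: normc_near1.
have : normc (\int[P0]_x normc (c x * phi x))%:C <= N * a
    + 8^-1 * \int[P0]_x normc (c x * phi x)
    + 9 / 8 * (\int[P1]_x normc (c x) * a).
  rewrite FE; apply: le_trans (normcD _ _) _; apply: lerD => //.
  apply: le_trans (normcB _ _) _; apply: lerD => //.
  by rewrite normc_opp -(mulr1 (N * a)).
rewrite normcC ger0_norm; first lra.
by apply: Rintegral_ge0 => x _; exact: normc_ge0.
Qed.

Let L0 := \int[P0]_x normc (c x).
Let L1 := \int[P1]_x normc (c x).

(** With [phi] and [psi] the conjugate phase of [c], the two estimates read [7/8 L1 <= N + L0/8] and
    [7/8 L0 <= N + 9/8 L1]. Both norms are finite by integrability, so the linear system can be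
    solved: 16/5 and 8/5 are its exact solution. *)
Let L01 : L0 <= 16 / 5 * N /\ L1 <= 8 / 5 * N.
Proof.
have mc := cintegrable_meas ci0.
have pb := bmeas_phase mc.
have cp x : c x * phasec (c x) = (normc (c x * phasec (c x)))%:C.
  by rewrite mul_phasec normcC ger0_norm ?normc_ge0.
have cpE (P : probability T R) :
    \int[P]_x normc (c x * phasec (c x)) = \int[P]_x normc (c x).
  by apply: eq_Rintegral => x _; rewrite mul_phasec normcC ger0_norm ?normc_ge0.
have s1 (P : probability T R) : sqint P (fun x => phasec (c x)) <= 1 ^+ 2.
  by apply: sqint_le_bound => // x; exact: normc_phase.
have := one_parameter_psi pb ltr01 (s1 _) cp.
have := one_parameter_phi pb ltr01 (s1 _) cp.
by rewrite !cpE -/L0 -/L1; split; lra.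
Qed.

(** Keeping the modulus of [alpha] but taking the conjugate phase of [c] makes [c psi] nonnegative
    without enlarging the test function; an arbitrary [alpha] is thus reduced to the estimates
    above. *)
Let test_fun_of alpha : bmeas alpha ->
  let psi x := (normc (alpha x))%:C * phasec (c x) in
  [/\ bmeas psi, forall x, c x * psi x = (normc (c x * psi x))%:C,
    forall x, normc (c x * psi x) = normc (c x * alpha x) &
    forall x, normc (psi x) <= normc (alpha x)].
Proof.
move=> ab psi.
have cpE x : c x * psi x = (normc (c x) * normc (alpha x))%:C.
  by rewrite /psi mulrCA mul_phasec -rmorphM mulrC.
have n0 x : 0 <= normc (c x) * normc (alpha x) by rewrite mulr_ge0 ?normc_ge0.
split.
- by apply: bmeasM; [exact: bmeas_norm|exact/bmeas_phase/cintegrable_meas/ci0].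
- by move=> x; rewrite cpE normcC ger0_norm.
- by move=> x; rewrite cpE normcC ger0_norm// normcM.
- move=> x; rewrite normcM normcC ger0_norm ?normc_ge0//.
  by rewrite ler_piMr ?normc_ge0// normc_phase.
Qed.

(** Inserting the bounds of [L01] into the estimates for [psi] and [phi] yields 8/5 on [P1] and 16/5
    on [P0]; the constant 4 is a common round value. *)
Lemma one_parameter1 alpha a : bmeas alpha -> 0 < a -> sqint P1 alpha <= a ^+ 2 ->
  normc (cintegral P1 setT (fun x => c x * alpha x)) <= 4 * N * a.
Proof.
move=> ab a0 aa; have [pb cp cpa pa] := test_fun_of ab.
set psi := fun x => _ in pb cp cpa pa.
have pe : sqint P1 psi <= a ^+ 2 by apply: le_trans aa; exact: sqint_le.
have [l0 l1] := L01.
have := one_parameter_psi pb a0 pe cp.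
have -> : \int[P1]_x normc (c x * psi x) = \int[P1]_x normc (c x * alpha x).
  by apply: eq_Rintegral => x _; exact: cpa.
rewrite -/L0.
have : normc (cintegral P1 setT (fun x => c x * alpha x)) <=
    \int[P1]_x normc (c x * alpha x).
  by apply: normc_cintegral_le; exact: cintegrableM.
have : L0 * a <= 16 / 5 * N * a by rewrite ler_wpM2r// ltW.
have : 0 <= N * a by rewrite mulr_ge0// ltW.
lra.
Qed.

Lemma one_parameter0 alpha a : bmeas alpha -> 0 < a -> sqint P0 alpha <= a ^+ 2 ->
  normc (cintegral P0 setT (fun x => c x * alpha x)) <= 4 * N * a.
Proof.
move=> ab a0 aa; have [pb cp cpa pa] := test_fun_of ab.
set psi := fun x => _ in pb cp cpa pa.
have pe : sqint P0 psi <= a ^+ 2 by apply: le_trans aa; exact: sqint_le.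
have [l0 l1] := L01.
have := one_parameter_phi pb a0 pe cp.
have -> : \int[P0]_x normc (c x * psi x) = \int[P0]_x normc (c x * alpha x).
  by apply: eq_Rintegral => x _; exact: cpa.
rewrite -/L1.
have : normc (cintegral P0 setT (fun x => c x * alpha x)) <=
    \int[P0]_x normc (c x * alpha x).
  by apply: normc_cintegral_le; exact: cintegrableM.
have : L1 * a <= 8 / 5 * N * a by rewrite ler_wpM2r// ltW.
have : 0 <= N * a by rewrite mulr_ge0// ltW.
lra.
Qed.

End one_parameter.

(** * The tensor bound *)

Lemma mpres_ae {R : realType} d1 d2 (X : measurableType d1) (Y : measurableType d2)
    (P : {measure set X -> \bar R}) (Q : {measure set Y -> \bar R}) f
    (A : Y -> Prop) :
  mpres P f Q -> {ae Q, forall y, A y} -> {ae P, forall x, A (f x)}.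
Proof.
move=> [mf PQ] [B [mB B0 AB]]; exists (f @^-1` B); split.
- by rewrite -[X in measurable X]setTI; exact: mf.
- by rewrite PQ.
- by move=> x /= nA; exact: AB.
Qed.

Section fubini_complements.
Context {R : realType} d1 d2 (X : measurableType d1) (Y : measurableType d2).
Variables (P : probability X R) (Q : probability Y R).
Implicit Types f : X * Y -> R[i].

Let swapped f : cintegrable (P \xx Q) setT f ->
  cintegrable (Q \xx P) setT (fun z => f (z.2, z.1)).
Proof. by move=> fi; exact: (mpres_cintegrable (mpres_swap Q P) fi). Qed.

Lemma cfubini_integrable2 f : cintegrable (P \xx Q) setT f ->
  cintegrable Q setT (fun y => cintegral P setT (fun x => f (x, y))).
Proof. by move=> /swapped fi; exact: cfubini_integrable fi. Qed.

Lemma cfubini2 f : cintegrable (P \xx Q) setT f ->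
  cintegral (P \xx Q) setT f =
  cintegral Q setT (fun y => cintegral P setT (fun x => f (x, y))).
Proof.
move=> fi; rewrite -(mpres_cintegral (mpres_swap Q P) fi).
exact: cfubini (swapped fi).
Qed.

Lemma ae_cintegrable2 f : cintegrable (P \xx Q) setT f ->
  {ae Q, forall y, cintegrable P setT (fun x => f (x, y))}.
Proof. by move=> /swapped fi; exact: ae_cintegrable fi. Qed.

Lemma cfubiniM f (g : X -> R[i]) : cintegrable (P \xx Q) setT f -> bmeas g ->
  cintegral (P \xx Q) setT (fun z => f z * g z.1) =
  cintegral P setT (fun x => cintegral Q setT (fun y => f (x, y)) * g x).
Proof.
move=> fi gb.
have fgi := cintegrableM fi (bmeas_fst Y gb).
rewrite cfubini//; apply: cintegral_ae.
- exact: cintegrable_meas (cfubini_integrable fgi).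
- by apply: cmeasurableM; [exact: cintegrable_meas (cfubini_integrable fi)|case: gb].
- by apply: filterS (ae_cintegrable fi) => x fx; rewrite /= cintegralZr.
Qed.

Lemma cfubiniM2 f (g : Y -> R[i]) : cintegrable (P \xx Q) setT f -> bmeas g ->
  cintegral (P \xx Q) setT (fun z => f z * g z.2) =
  cintegral Q setT (fun y => cintegral P setT (fun x => f (x, y)) * g y).
Proof.
move=> fi gb.
have fgi := cintegrableM fi (bmeas_snd X gb).
rewrite cfubini2//; apply: cintegral_ae.
- exact: cintegrable_meas (cfubini_integrable2 fgi).
- by apply: cmeasurableM; [exact: cintegrable_meas (cfubini_integrable2 fi)|case: gb].
- by apply: filterS (ae_cintegrable2 fi) => x fx; rewrite /= cintegralZr.
Qed.

Lemma sqint_tensor (f : X -> R[i]) (g : Y -> R[i]) : bmeas f -> bmeas g ->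
  sqint (P \xx Q) (fun z => f z.1 * g z.2) = sqint P f * sqint Q g.
Proof.
move=> fb gb.
have sqb d (T : measurableType d) (h : T -> R[i]) : bmeas h ->
    bmeas (fun x => ((normc (h x)) ^+ 2)%:C).
  move=> hb; have := bmeasM (bmeas_norm hb) (bmeas_norm hb); congr bmeas.
  by apply/funext => x; rewrite -rmorphM expr2.
apply: (@complexI R); rewrite rmorphM/= -!cintegral_real.
rewrite -cintegral_prodl; [|exact/cintegrable_bmeas/sqb|exact: sqb].
by apply: eq_cintegral => z; rewrite normcM exprMn rmorphM.
Qed.

End fubini_complements.

Section two_parameters.
Context {R : realType} d1 d2 (T1 : measurableType d1) (T2 : measurableType d2).
(** Index [false] is the original cube [I] or [J], where the input variables [u], [v] live; [true]
    is the reflected cube, home of the output variables [x], [y]. *)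
Variables (mu : bool -> probability T1 R) (nu : bool -> probability T2 R).
Variables (b : T1 * T2 -> R[i]) (k1 : T1 * T1 -> R[i]) (k2 : T2 * T2 -> R[i]).
Variable N : R.
Hypothesis bi : forall i j, cintegrable (mu i \xx nu j) setT b.
Hypotheses (mk1 : cmeasurable setT k1) (k11 : forall z, normc (k1 z - 1) <= 8^-1).
Hypotheses (mk2 : cmeasurable setT k2) (k21 : forall z, normc (k2 z - 1) <= 8^-1).
Hypothesis N0 : 0 <= N.
Hypothesis b0l : forall j,
  {ae nu j, forall t, cintegral (mu false) setT (fun s => b (s, t)) = 0}.
Hypothesis b0r : forall i,
  {ae mu i, forall s, cintegral (nu false) setT (fun t => b (s, t)) = 0}.

Definition double_diff (z w : T1 * T2) : R[i] :=
  b z - b (z.1, w.2) - b (w.1, z.2) + b w.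

Hypothesis H : forall phi psi a e, bmeas phi -> bmeas psi -> 0 < a -> 0 < e ->
  sqint (mu false \xx nu false) phi <= a ^+ 2 ->
  sqint (mu true \xx nu true) psi <= e ^+ 2 ->
  normc (cintegral ((mu true \xx nu true) \xx (mu false \xx nu false)) setT
    (fun p => double_diff p.1 p.2 * k1 (p.1.1, p.2.1) * k2 (p.1.2, p.2.2) *
      phi p.2 * psi p.1)) <= N * a * e.

Let k1b : bmeas k1 := bmeas_near1 mk1 k11.
Let k2b : bmeas k2 := bmeas_near1 mk2 k21.

Local Notation ka := (nu true \xx nu false).
(** Difference of [b] in the second variable. The double difference is [be (x, q) - be (u, q)] with
    [q = (y, v)], so integrating out [q] leaves a one-parameter form in [x], [u]. *)
Let be (z : T1 * (T2 * T2)) := b (z.1, z.2.1) - b (z.1, z.2.2).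

Let be_integrable i : cintegrable (mu i \xx ka) setT be.
Proof.
apply: cintegrableB.
  exact: (mpres_cintegrable (mpres_prod (mpres_id (mu i))
    (mpres_fst (nu true) (nu false))) (bi i true)).
exact: (mpres_cintegrable (mpres_prod (mpres_id (mu i))
  (mpres_snd (nu true) (nu false))) (bi i false)).
Qed.

Section first_variable.
Variables (phi psi : T2 -> R[i]) (a e : R).
Hypotheses (phib : bmeas phi) (psib : bmeas psi) (a0 : 0 < a) (e0 : 0 < e).
Hypotheses (phia : sqint (nu false) phi <= a ^+ 2).
Hypotheses (psie : sqint (nu true) psi <= e ^+ 2).

Let h (q : T2 * T2) := k2 q * psi q.1 * phi q.2.
Let hb : bmeas h.
Proof.
apply: bmeasM; last exact: bmeas_snd.
by apply: bmeasM => //; exact: bmeas_fst.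
Qed.

Let beh i : cintegrable (mu i \xx ka) setT (fun z => be z * h z.2).
Proof. by apply: cintegrableM => //; exact: bmeas_snd. Qed.

Let c s := cintegral ka setT (fun q => be (s, q) * h q).

Let ci i : cintegrable (mu i) setT c.
Proof. exact: (cfubini_integrable (beh i)). Qed.

(** After exchanging the integrals, the inner one is the mean over [I] of [b(., y) - b(., v)], which
    vanishes for almost every [y] in [J'] and [v] in [J]: both instances of [b0l] enter. *)
Let c0 : cintegral (mu false) setT c = 0.
Proof.
rewrite -(cfubini (beh false)) cfubiniM2//.
rewrite -[RHS](cintegral_prob_cst ka); apply: cintegral_ae.
- apply: cmeasurableM; last by case: hb.
  exact: cintegrable_meas (cfubini_integrable2 (be_integrable false)).
- exact: cmeasurable_cst.
have z1 := mpres_ae (mpres_fst (nu true) (nu false)) (b0l true).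
have z2 := mpres_ae (mpres_snd (nu true) (nu false)) (b0l false).
have i1 := mpres_ae (mpres_fst (nu true) (nu false))
  (ae_cintegrable2 (bi false true)).
have i2 := mpres_ae (mpres_snd (nu true) (nu false))
  (ae_cintegrable2 (bi false false)).
near=> q.
rewrite /be /= cintegralB; [|by near: q|by near: q].
have -> : cintegral (mu false) setT (fun s => b (s, q.1)) = 0 by near: q.
have -> : cintegral (mu false) setT (fun s => b (s, q.2)) = 0 by near: q.
by rewrite subrr mul0r.
Unshelve. all: by end_near. Qed.

(** [H] is tested on the tensor products of [phi1] with [phi] and of [psi1] with [psi]: after
    regrouping by parameter, the integral over [(y, v)] turns [be] into [c]. *)
Let Hc (phi1 psi1 : T1 -> R[i]) a1 e1 : bmeas phi1 -> bmeas psi1 ->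
  0 < a1 -> 0 < e1 -> sqint (mu false) phi1 <= a1 ^+ 2 ->
  sqint (mu true) psi1 <= e1 ^+ 2 ->
  normc (cintegral (mu true \xx mu false) setT (fun z =>
    (c z.1 - c z.2) * k1 z * psi1 z.1 * phi1 z.2)) <= N * a * e * a1 * e1.
Proof.
move=> p1b q1b a10 e10 p1a q1e.
have := H (phi := fun w => phi1 w.1 * phi w.2) (psi := fun z => psi1 z.1 * psi z.2)
  (a := a1 * a) (e := e1 * e).
move=> /(_ (bmeasM (bmeas_fst _ p1b) (bmeas_snd _ phib))).
move=> /(_ (bmeasM (bmeas_fst _ q1b) (bmeas_snd _ psib))).
move=> /(_ (mulr_gt0 a10 a0) (mulr_gt0 e10 e0)).
rewrite !sqint_tensor// !exprMn => /(_ (ler_pM (sqint_ge0 _ _) (sqint_ge0 _ _) p1a phia)).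
move=> /(_ (ler_pM (sqint_ge0 _ _) (sqint_ge0 _ _) q1e psie)).
have -> : N * (a1 * a) * (e1 * e) = N * a * e * a1 * e1 by ring.
apply: le_trans; rewrite le_eqVlt; apply/orP; left; apply/eqP; congr normc.
pose g (p : T1 * T1) := k1 p * psi1 p.1 * phi1 p.2.
have gb : bmeas g.
  apply: bmeasM; last exact: bmeas_snd.
  by apply: bmeasM => //; exact: bmeas_fst.
pose G (z : (T1 * T1) * (T2 * T2)) :=
  be (z.1.1, z.2) * h z.2 - be (z.1.2, z.2) * h z.2.
have m1 := mpres_prod (mpres_fst (mu true) (mu false)) (mpres_id ka).
have m2 := mpres_prod (mpres_snd (mu true) (mu false)) (mpres_id ka).
have Gi : cintegrable ((mu true \xx mu false) \xx ka) setT G.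
  apply: cintegrableB.
    exact: (mpres_cintegrable m1 (beh true)).
  exact: (mpres_cintegrable m2 (beh false)).
have Ggi : cintegrable ((mu true \xx mu false) \xx ka) setT (fun z => G z * g z.1).
  by apply: cintegrableM => //; exact: bmeas_fst.
transitivity (cintegral ((mu true \xx mu false) \xx ka) setT (fun z => G z * g z.1)).
  rewrite cfubiniM//; apply: cintegral_ae.
  - rewrite (_ : (fun z => _) = (fun z => (c z.1 - c z.2) * g z)); last first.
      by apply/funext => z; rewrite /g; ring.
    apply: cmeasurableM; last by case: gb.
    apply: cmeasurableB.
      exact: cmeasurable_comp measurable_fst (cintegrable_meas (ci true)).
    exact: cmeasurable_comp measurable_snd (cintegrable_meas (ci true)).
  - apply: cmeasurableM; last by case: gb.
    exact: cintegrable_meas (cfubini_integrable Gi).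
  have i1 := mpres_ae (mpres_fst (mu true) (mu false)) (ae_cintegrable (beh true)).
  have i2 := mpres_ae (mpres_snd (mu true) (mu false)) (ae_cintegrable (beh false)).
  near=> p.
  rewrite /G cintegralB/=; [|by near: p|by near: p].
  by rewrite /c /g; ring.
rewrite -(mpres_cintegral (mpres_transpose4 (mu true) (nu true) (mu false) (nu false)) Ggi).
apply: eq_cintegral => -[[x y] [u v]].
by rewrite /double_diff /G /g /be /h /=; ring.
Unshelve. all: by end_near. Qed.

(** Read with [alpha] fixed and [phi], [psi] varying, this is the hypothesis of the one-parameter
    estimate in the second variable, for the function [t -> integral of b(s,t) alpha(s)] and the
    constant [4 N r]. *)
Lemma first_variable_bound i alpha r : bmeas alpha -> 0 < r ->
  sqint (mu i) alpha <= r ^+ 2 ->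
  normc (cintegral (mu i \xx ka) setT (fun z => be z * alpha z.1 *
    (k2 z.2 * psi z.2.1 * phi z.2.2))) <= 4 * N * a * e * r.
Proof.
move=> ab r0 ar.
have -> : cintegral (mu i \xx ka) setT (fun z => be z * alpha z.1 *
    (k2 z.2 * psi z.2.1 * phi z.2.2)) = cintegral (mu i) setT (fun s => c s * alpha s).
  rewrite -(cfubiniM (beh i) ab); apply: eq_cintegral => -[s q] /=.
  by rewrite /h; ring.
have N'0 : 0 <= N * a * e by rewrite !mulr_ge0// ltW.
have -> : 4 * N * a * e * r = 4 * (N * a * e) * r by ring.
case: i ar => ar.
  exact: (one_parameter1 (ci false) (ci true) c0 mk1 k11 N'0 Hc).
exact: (one_parameter0 (ci false) (ci true) c0 mk1 k11 N'0 Hc).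
Qed.

End first_variable.

Section second_variable.
Variables (i : bool) (alpha : T1 -> R[i]) (r : R).
Hypotheses (ab : bmeas alpha) (r0 : 0 < r) (ar : sqint (mu i) alpha <= r ^+ 2).

Let ba j : cintegrable (mu i \xx nu j) setT (fun z => b z * alpha z.1).
Proof. by apply: cintegrableM => //; exact: bmeas_fst. Qed.

Let c t := cintegral (mu i) setT (fun s => b (s, t) * alpha s).

Let ci j : cintegrable (nu j) setT c.
Proof. exact: (cfubini_integrable2 (ba j)). Qed.

Let c0 : cintegral (nu false) setT c = 0.
Proof.
rewrite -(cfubini2 (ba false)) cfubiniM//.
rewrite -[RHS](cintegral_prob_cst (mu i)); apply: cintegral_ae.
- apply: cmeasurableM; last by case: ab.
  exact: cintegrable_meas (cfubini_integrable (bi i false)).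
- exact: cmeasurable_cst.
by apply: filterS (b0r i) => s ->; rewrite mul0r.
Qed.

Let Hc (phi psi : T2 -> R[i]) a e : bmeas phi -> bmeas psi ->
  0 < a -> 0 < e -> sqint (nu false) phi <= a ^+ 2 ->
  sqint (nu true) psi <= e ^+ 2 ->
  normc (cintegral ka setT (fun z =>
    (c z.1 - c z.2) * k2 z * psi z.1 * phi z.2)) <= 4 * N * r * a * e.
Proof.
move=> pb qb a0 e0 pa qe.
have -> : 4 * N * r * a * e = 4 * N * a * e * r by ring.
have := first_variable_bound pb qb a0 e0 pa qe ab r0 ar.
apply: le_trans; rewrite le_eqVlt; apply/orP; left; apply/eqP; congr normc.
have bai : cintegrable (mu i \xx ka) setT (fun z => be z * alpha z.1).
  by apply: cintegrableM => //; exact: bmeas_fst.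
have hb : bmeas (fun q => k2 q * psi q.1 * phi q.2).
  apply: bmeasM; last exact: bmeas_snd.
  by apply: bmeasM => //; exact: bmeas_fst.
rewrite (cfubiniM2 bai hb); apply: cintegral_ae.
- rewrite (_ : (fun z => _) = (fun z => (c z.1 - c z.2) * (k2 z * psi z.1 * phi z.2))).
    apply: cmeasurableM; last by case: hb.
    apply: cmeasurableB.
      exact: cmeasurable_comp measurable_fst (cintegrable_meas (ci true)).
    exact: cmeasurable_comp measurable_snd (cintegrable_meas (ci true)).
  by apply/funext => z; ring.
- apply: cmeasurableM; last by case: hb.
  exact: cintegrable_meas (cfubini_integrable2 bai).
have i1 := mpres_ae (mpres_fst (nu true) (nu false)) (ae_cintegrable2 (ba true)).
have i2 := mpres_ae (mpres_snd (nu true) (nu false)) (ae_cintegrable2 (ba false)).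
near=> q.
rewrite (_ : cintegral (mu i) setT _ = c q.1 - c q.2); first by ring.
rewrite /c -cintegralB; [|by near: q|by near: q].
by apply: eq_cintegral => s; rewrite /be /=; ring.
Unshelve. all: by end_near. Qed.

(** Second use of the one-parameter estimate, whence 16 = 4 * 4. The indices [i], [j] are free
    because that estimate has a version on either cube. *)
Lemma tensor_bound j gamma a : bmeas gamma -> 0 < a ->
  sqint (nu j) gamma <= a ^+ 2 ->
  normc (cintegral (mu i \xx nu j) setT (fun z => b z * alpha z.1 * gamma z.2)) <=
  16 * N * r * a.
Proof.
move=> gb a0 ga; rewrite (cfubiniM2 (ba j) gb).
have N'0 : 0 <= 4 * N * r by rewrite !mulr_ge0// ltW.
have -> : 16 * N * r * a = 4 * (4 * N * r) * a by ring.
case: j ga => ga.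
  exact: (one_parameter1 (ci false) (ci true) c0 mk2 k21 N'0 Hc).
exact: (one_parameter0 (ci false) (ci true) c0 mk2 k21 N'0 Hc).
Qed.

End second_variable.
End two_parameters.

(** * The square function of the oscillation *)

Section fibre_bounds.
Context {R : realType}.

Lemma sqint_leM d (T : measurableType d) (P : probability T R) (f g : T -> R[i]) (M : R) :
  bmeas f -> bmeas g ->
  (forall x, normc (f x) <= M * normc (g x)) -> sqint P f <= M ^+ 2 * sqint P g.
Proof.
move=> fb gb fg; rewrite /sqint -RintegralZl//; last exact: integrable_sq.
apply: le_Rintegral => //; first exact: integrable_sq.
  exact: (integrableZl measurableT _ (integrable_sq P gb)).
move=> x _; rewrite -exprMn lerXn2r ?nnegrE ?normc_ge0//.
by rewrite (le_trans _ (fg x)) ?normc_ge0.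
Qed.

Lemma normc_cfubini_bound d1 d2 (X : measurableType d1) (Y : measurableType d2)
    (P : probability X R) (Q : probability Y R) (f : X * Y -> R[i]) (g : X -> R) :
  cintegrable (P \xx Q) setT f -> P.-integrable setT (EFin \o g) ->
  (forall x, normc (cintegral Q setT (fun y => f (x, y))) <= g x) ->
  normc (cintegral (P \xx Q) setT f) <= \int[P]_x g x.
Proof.
move=> fi gi fg; rewrite cfubini//; apply: normc_cintegral_bound => //.
exact: cintegrable_meas (cfubini_integrable fi).
Qed.

Lemma amgm_sqr (s l : R) : 0 <= s -> 0 < l ->
  0 < s / l + l / 2 /\ 2 * s <= (s / l + l / 2) ^+ 2.
Proof.
move=> s0 l0; split.
  by apply: ltr_wpDl; rewrite ?divr_ge0 ?divr_gt0// ltW.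
rewrite -subr_ge0.
have -> : (s / l + l / 2) ^+ 2 - 2 * s = (s / l - l / 2) ^+ 2.
  by field; rewrite gt_eqF.
exact: sqr_ge0.
Qed.

(** Take [l] to be the square root of [A]. With [A] the squared norm of [phi], this divides
    [|phi|^2 <= K |phi|] by [|phi|]. *)
Lemma le_sqr_of_le_linear (A K : R) : 0 <= A -> 0 <= K ->
  (forall l, 0 < l -> A <= l ^+ 2 -> A <= K * l) -> A <= K ^+ 2.
Proof.
move=> A0 K0 AK; have [->|An0] := eqVneq A 0; first exact: sqr_ge0.
have A1 : 0 < A by rewrite lt_def An0.
have s0 : 0 < Num.sqrt A by rewrite sqrtr_gt0.
have := AK _ s0; rewrite sqr_sqrtr// => /(_ (lexx _)).
rewrite -{1}(sqr_sqrtr A0) expr2 ler_pM2r// => sK.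
by rewrite -(sqr_sqrtr A0) lerXn2r ?nnegrE ?sqrtr_ge0.
Qed.

End fibre_bounds.

Section square_function.
Context {R : realType} d1 d2 (T1 : measurableType d1) (T2 : measurableType d2).
Variables (mu : bool -> probability T1 R) (nu : bool -> probability T2 R).
Variables (b : T1 * T2 -> R[i]) (k1 : T1 * T1 -> R[i]) (k2 : T2 * T2 -> R[i]).
Variable N : R.
Hypothesis bi : forall i j, cintegrable (mu i \xx nu j) setT b.
Hypotheses (k1b : bmeas k1) (k11 : forall z, normc (k1 z - 1) <= 8^-1).
Hypotheses (k2b : bmeas k2) (k21 : forall z, normc (k2 z - 1) <= 8^-1).
Hypothesis N0 : 0 <= N.
Hypothesis H : forall phi a, bmeas phi -> 0 < a ->
  sqint (mu false \xx nu false) phi <= a ^+ 2 ->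
  normc (cintegral ((mu true \xx nu true) \xx (mu false \xx nu false)) setT
    (fun p => double_diff b p.1 p.2 * k1 (p.1.1, p.2.1) * k2 (p.1.2, p.2.2) *
      phi p.2)) <= N * a.
Hypothesis tensor : forall i j alpha gamma a e, bmeas alpha -> bmeas gamma ->
  0 < a -> 0 < e -> sqint (mu i) alpha <= a ^+ 2 -> sqint (nu j) gamma <= e ^+ 2 ->
  normc (cintegral (mu i \xx nu j) setT (fun z => b z * alpha z.1 * gamma z.2)) <=
  16 * N * a * e.

Let k1l u : bmeas (fun x => k1 (x, u)).
Proof. exact: bmeas_comp (pair2_measurable u) k1b. Qed.
Let k2l v : bmeas (fun y => k2 (y, v)).
Proof. exact: bmeas_comp (pair2_measurable v) k2b. Qed.
Let k1r x : bmeas (fun u => k1 (x, u)).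
Proof. exact: bmeas_comp (pair1_measurable x) k1b. Qed.
Let k2r y : bmeas (fun v => k2 (y, v)).
Proof. exact: bmeas_comp (pair1_measurable y) k2b. Qed.

Let sqint_k1l i u : sqint (mu i) (fun x => k1 (x, u)) <= 2 ^+ 2.
Proof. by apply: sqint_le_bound => // x; have := normc_near1 (k11 (x, u)); lra. Qed.

Let sqint_k2l j v : sqint (nu j) (fun y => k2 (y, v)) <= 2 ^+ 2.
Proof. by apply: sqint_le_bound => // y; have := normc_near1 (k21 (y, v)); lra. Qed.

Let sqint_mul (d : measure_display) (T : measurableType d)
    (P : probability T R) (k f : T -> R[i]) (l : R) :
  0 < l -> bmeas k -> bmeas f -> (forall x, normc (k x) <= 9 / 8) ->
  sqint P (fun x => k x * f x) <= (sqint P f / l + l / 2) ^+ 2.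
Proof.
move=> l0 kb fb kle; have [_] := amgm_sqr (sqint_ge0 P f) l0.
apply: le_trans; apply: (@le_trans _ _ ((9 / 8) ^+ 2 * sqint P f)).
  apply: sqint_leM => //; first exact: bmeasM.
  by move=> x; rewrite normcM ler_wpM2r ?normc_ge0.
by rewrite ler_wpM2r ?sqint_ge0//; lra.
Qed.

Local Notation Pz := (mu true \xx nu true).
Local Notation Pw := (mu false \xx nu false).

Section test_function.
Variables (phi : T1 * T2 -> R[i]) (l : R).
Hypotheses (pb : bmeas phi) (l0 : 0 < l) (pl : sqint Pw phi <= l ^+ 2).

Let phir u : bmeas (fun v => phi (u, v)).
Proof. exact: bmeas_comp (pair1_measurable u) pb. Qed.
Let phil v : bmeas (fun u => phi (u, v)).
Proof. exact: bmeas_comp (pair2_measurable v) pb. Qed.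

(** [F x] is the squared norm of a slice of [phi]. In [32 = 16 * 2], 16 comes from the tensor bound
    and 2 bounds the norm of the kernel slice that forms the other factor; [F/l + l/2] integrates to
    at most [3l/2], hence 48. *)
Let bound_integral d (T : measurableType d) (P : probability T R) (F : T -> R) :
  P.-integrable setT (EFin \o F) -> \int[P]_x F x <= l ^+ 2 ->
  let g x := 32 * N * (F x / l + l / 2) in
  P.-integrable setT (EFin \o g) /\ \int[P]_x g x <= 48 * N * l.
Proof.
move=> Fi Fl g.
have Fi' : P.-integrable setT (EFin \o (fun x => l^-1 * F x)).
  exact: (integrableZl measurableT _ Fi).
have ci : P.-integrable setT (EFin \o (fun=> l / 2)).
  exact: finite_measure_integrable_cst.
have gE : g = fun x => 32 * N * (l^-1 * F x + l / 2).
  by apply/funext => x; rewrite /g mulrC (mulrC (F x)) mulrC.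
have si : P.-integrable setT (EFin \o (fun x => l^-1 * F x + l / 2)).
  exact: (integrableD measurableT Fi' ci).
rewrite gE; split; first exact: (integrableZl measurableT _ si).
rewrite RintegralZl// RintegralD// Rintegral_prob_cst RintegralZl//.
have -> : 48 * N * l = 32 * N * (l^-1 * l ^+ 2 + l / 2).
  by field; rewrite gt_eqF.
apply: ler_wpM2l; first by rewrite mulr_ge0.
by rewrite lerD2r ler_wpM2l// invr_ge0 ltW.
Qed.

(* In each of the three cross terms, two of the four variables of [k1] and [k2]
   are frozen: what remains is [b] tested against a tensor product. *)
Let cross00 : normc (cintegral (Pz \xx Pw) setT (fun p => b p.1 *
  k1 (p.1.1, p.2.1) * k2 (p.1.2, p.2.2) * phi p.2)) <= 48 * N * l.
Proof.
(* Frozen: [u] and [v], so that [phi] is a scalar, attached to the second factor. *)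
pose f (q : (T1 * T2) * (T1 * T2)) :=
  b q.2 * k1 (q.2.1, q.1.1) * (k2 (q.2.2, q.1.2) * phi q.1).
have fi : cintegrable (Pw \xx Pz) setT f.
  apply: cintegrableM; first apply: cintegrableM.
  - exact: cintegrable_snd (bi true true).
  - apply: bmeas_comp k1b.
    by apply: measurable_fun_pair; apply: measurableT_comp.
  - apply: bmeasM; last exact: bmeas_fst.
    apply: bmeas_comp k2b.
    by apply: measurable_fun_pair; apply: measurableT_comp.
rewrite (_ : cintegral _ _ _ = cintegral (Pw \xx Pz) setT f); last first.
  rewrite -(mpres_cintegral (mpres_swap Pz Pw) fi).
  by apply: eq_cintegral => p; rewrite /f /=; ring.
have [gi gl] := bound_integral (integrable_sq Pw pb) pl.
apply: le_trans gl; apply: normc_cfubini_bound => // w.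
have [e0 e2] := amgm_sqr (sqr_ge0 (normc (phi w))) l0.
have gb : bmeas (fun y => k2 (y, w.2) * phi w) by apply: bmeasM => //; exact: bmeas_cst.
have := @tensor true true (fun x => k1 (x, w.1)) (fun y => k2 (y, w.2) * phi w)
  2 (normc (phi w) ^+ 2 / l + l / 2) (k1l _) gb _ e0 (sqint_k1l _ _).
rewrite (_ : 16 * N * 2 = 32 * N); last by ring.
apply => //; apply: le_trans e2.
apply: le_trans (sqint_le_bound (M := 9 / 8 * normc (phi w)) _ gb _) _ => [y|].
  by rewrite normcM ler_wpM2r ?normc_ge0//; exact: normc_near1.
by rewrite exprMn ler_wpM2r ?sqr_ge0//; lra.
Qed.

Let cross10 : normc (cintegral (Pz \xx Pw) setT (fun p => b (p.1.1, p.2.2) *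
  k1 (p.1.1, p.2.1) * k2 (p.1.2, p.2.2) * phi p.2)) <= 48 * N * l.
Proof.
(* Frozen: [y] and [u]. The slice [v -> phi (u, v)] joins the factor in the second variable. *)
pose f (q : (T2 * T1) * (T1 * T2)) :=
  b q.2 * k1 (q.2.1, q.1.2) * (k2 (q.1.1, q.2.2) * phi (q.1.2, q.2.2)).
have fi : cintegrable ((nu true \xx mu false) \xx (mu true \xx nu false)) setT f.
  apply: cintegrableM; first apply: cintegrableM.
  - exact: cintegrable_snd (bi true false).
  - apply: bmeas_comp k1b.
    by apply: measurable_fun_pair; apply: measurableT_comp.
  - apply: bmeasM.
      apply: bmeas_comp k2b.
      by apply: measurable_fun_pair; apply: measurableT_comp.
    apply: bmeas_comp pb.
    by apply: measurable_fun_pair; apply: measurableT_comp.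
rewrite (_ : cintegral _ _ _ =
    cintegral ((nu true \xx mu false) \xx (mu true \xx nu false)) setT f); last first.
  have m := mpres_comp (mpres_prod (mpres_swap (mu true) (nu true)) (mpres_id Pw))
    (mpres_transpose4 (nu true) (mu true) (mu false) (nu false)).
  rewrite -(mpres_cintegral m fi).
  by apply: eq_cintegral => -[[x y] [u v]]; rewrite /f /=; ring.
have [Fi FE] := Rfubini (integrable_sq Pw pb).
have := bound_integral Fi; rewrite FE => /(_ pl) [gi gl].
have [gi' gl'] := mpres_integrable (mpres_snd (nu true) (mu false)) gi.
apply: le_trans gl; rewrite -gl'.
apply: normc_cfubini_bound => // -[y u] /=.
have [e0 _] := amgm_sqr (sqint_ge0 (nu false) (fun v => phi (u, v))) l0.
have gb : bmeas (fun v => k2 (y, v) * phi (u, v)) by exact: bmeasM.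
have := @tensor true false (fun x => k1 (x, u)) (fun v => k2 (y, v) * phi (u, v))
  2 _ (k1l _) gb _ e0 (sqint_k1l _ _).
rewrite (_ : 16 * N * 2 = 32 * N); last by ring.
apply => //; apply: sqint_mul => // v; exact: normc_near1.
Qed.

Let cross01 : normc (cintegral (Pz \xx Pw) setT (fun p => b (p.2.1, p.1.2) *
  k1 (p.1.1, p.2.1) * k2 (p.1.2, p.2.2) * phi p.2)) <= 48 * N * l.
Proof.
(* Frozen: [x] and [v]. The slice [u -> phi (u, v)] joins the factor in the first variable. *)
pose f (q : (T1 * T2) * (T1 * T2)) :=
  b q.2 * (k1 (q.1.1, q.2.1) * phi (q.2.1, q.1.2)) * k2 (q.2.2, q.1.2).
have fi : cintegrable ((mu true \xx nu false) \xx (mu false \xx nu true)) setT f.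
  apply: cintegrableM; first apply: cintegrableM.
  - exact: cintegrable_snd (bi false true).
  - apply: bmeasM.
      apply: bmeas_comp k1b.
      by apply: measurable_fun_pair; apply: measurableT_comp.
    apply: bmeas_comp pb.
    by apply: measurable_fun_pair; apply: measurableT_comp.
  - apply: bmeas_comp k2b.
    by apply: measurable_fun_pair; apply: measurableT_comp.
rewrite (_ : cintegral _ _ _ =
    cintegral ((mu true \xx nu false) \xx (mu false \xx nu true)) setT f); last first.
  have m1 := mpres_comp (mpres_prod (mpres_id Pz) (mpres_swap (mu false) (nu false)))
    (mpres_transpose4 (mu true) (nu true) (nu false) (mu false)).
  have m := mpres_comp m1 (mpres_prod (mpres_id (mu true \xx nu false))
    (mpres_swap (nu true) (mu false))).
  rewrite -(mpres_cintegral m fi).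
  by apply: eq_cintegral => -[[x y] [u v]]; rewrite /f /=; ring.
have sqi := integrable_sq Pw pb.
have [sqi' sqE] := mpres_integrable (mpres_swap (nu false) (mu false)) sqi.
have [Fi FE] := Rfubini sqi'.
have := bound_integral Fi; rewrite FE sqE => /(_ pl) [gi gl].
have [gi' gl'] := mpres_integrable (mpres_snd (mu true) (nu false)) gi.
apply: le_trans gl; rewrite -gl'.
apply: normc_cfubini_bound => // -[x v] /=.
have [e0 _] := amgm_sqr (sqint_ge0 (mu false) (fun u => phi (u, v))) l0.
have gb : bmeas (fun u => k1 (x, u) * phi (u, v)) by exact: bmeasM.
have := @tensor false true (fun u => k1 (x, u) * phi (u, v)) (fun y => k2 (y, v))
  _ 2 gb (k2l _) e0 _ _ (sqint_k2l _ _).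
rewrite (_ : forall z : R, 16 * N * z * 2 = 32 * N * z); last by move=> z; ring.
apply => //; apply: sqint_mul => // u; exact: normc_near1.
Qed.

(** Isolates the main term: the whole form is at most [N l], each of the three cross terms at most
    [48 N l], and 145 = 1 + 3 * 48. *)
Let cross_bound : normc (cintegral (Pz \xx Pw) setT (fun p => b p.2 *
  k1 (p.1.1, p.2.1) * k2 (p.1.2, p.2.2) * phi p.2)) <= 145 * N * l.
Proof.
have km (h : (T1 * T2) * (T1 * T2) -> T1 * T2) : measurable_fun setT h ->
    forall i j, mpres (Pz \xx Pw) h (mu i \xx nu j) ->
    cintegrable (Pz \xx Pw) setT (fun p => b (h p) *
      k1 (p.1.1, p.2.1) * k2 (p.1.2, p.2.2) * phi p.2).
  move=> mh i j hm; apply: cintegrableM; last exact: bmeas_snd.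
  apply: cintegrableM.
    apply: cintegrableM; first exact: (mpres_cintegrable hm (bi i j)).
    apply: bmeas_comp k1b.
    by apply: measurable_fun_pair; apply: measurableT_comp.
  apply: bmeas_comp k2b.
  by apply: measurable_fun_pair; apply: measurableT_comp.
have m4 := mpres_transpose4 (mu true) (nu true) (mu false) (nu false).
have m10 : mpres (Pz \xx Pw) (fun p => (p.1.1, p.2.2)) (mu true \xx nu false).
  exact: (mpres_comp m4 (mpres_prod (mpres_fst (mu true) (mu false))
    (mpres_snd (nu true) (nu false)))).
have m01 : mpres (Pz \xx Pw) (fun p => (p.2.1, p.1.2)) (mu false \xx nu true).
  exact: (mpres_comp m4 (mpres_prod (mpres_snd (mu true) (mu false))
    (mpres_fst (nu true) (nu false)))).
have i00 := km _ (mpres_fst Pz Pw).1 _ _ (mpres_fst Pz Pw).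
have i11 := km _ (mpres_snd Pz Pw).1 _ _ (mpres_snd Pz Pw).
have i10 := km _ m10.1 _ _ m10.
have i01 := km _ m01.1 _ _ m01.
have := H pb l0 pl; set F := cintegral _ _ _ => HF.
set G := cintegral _ _ _.
have -> : G = F - cintegral (Pz \xx Pw) setT (fun p => b p.1 *
    k1 (p.1.1, p.2.1) * k2 (p.1.2, p.2.2) * phi p.2) +
  cintegral (Pz \xx Pw) setT (fun p => b (p.1.1, p.2.2) *
    k1 (p.1.1, p.2.1) * k2 (p.1.2, p.2.2) * phi p.2) +
  cintegral (Pz \xx Pw) setT (fun p => b (p.2.1, p.1.2) *
    k1 (p.1.1, p.2.1) * k2 (p.1.2, p.2.2) * phi p.2).
  have -> : F = cintegral (Pz \xx Pw) setT (fun p => b p.1 *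
      k1 (p.1.1, p.2.1) * k2 (p.1.2, p.2.2) * phi p.2) -
    cintegral (Pz \xx Pw) setT (fun p => b (p.1.1, p.2.2) *
      k1 (p.1.1, p.2.1) * k2 (p.1.2, p.2.2) * phi p.2) -
    cintegral (Pz \xx Pw) setT (fun p => b (p.2.1, p.1.2) *
      k1 (p.1.1, p.2.1) * k2 (p.1.2, p.2.2) * phi p.2) + G.
    have i1 := cintegrableB i00 i10.
    have i2 := cintegrableB i1 i01.
    rewrite /G -(cintegralB i00 i10) -(cintegralB i1 i01) -(cintegralD i2 i11).
    by apply: eq_cintegral => p; rewrite /double_diff; ring.
  by ring.
apply: le_trans (normcD _ _) _.
have -> : 145 * N * l = (N * l + 48 * N * l + 48 * N * l) + 48 * N * l by ring.
apply: lerD => //; apply: le_trans (normcD _ _) _; apply: lerD => //.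
by apply: le_trans (normcB _ _) _; apply: lerD.
Qed.

(** Replacing [k1 k2] by 1 in the main term gives exactly [sqint Pw phi], with an error of at most
    half of it. Absorbing that half is legitimate because [phi] is bounded; it doubles 145 to
    290. *)
Lemma main_term_bound : (forall w, b w * phi w = (normc (phi w) ^+ 2)%:C) ->
  sqint Pw phi <= 290 * N * l.
Proof.
move=> bphi.
have bpi : cintegrable Pw setT (fun w => b w * phi w) by exact: cintegrableM.
have bpW := cintegrable_snd Pz bpi.
have k1P : bmeas (fun p : (T1 * T2) * (T1 * T2) => k1 (p.1.1, p.2.1)).
  apply: bmeas_comp k1b.
  by apply: measurable_fun_pair; apply: measurableT_comp.
have k2P : bmeas (fun p : (T1 * T2) * (T1 * T2) => k2 (p.1.2, p.2.2)).
  apply: bmeas_comp k2b.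
  by apply: measurable_fun_pair; apply: measurableT_comp.
have eb : bmeas (fun p : (T1 * T2) * (T1 * T2) =>
    k1 (p.1.1, p.2.1) * k2 (p.1.2, p.2.2) - 1).
  by apply: bmeasD; [exact: bmeasM|exact: bmeas_cst].
have Ei := cintegrableM bpW eb.
have AE : cintegral (Pz \xx Pw) setT (fun p => b p.2 * phi p.2) = (sqint Pw phi)%:C.
  rewrite (mpres_cintegral (mpres_snd Pz Pw) bpi) -cintegral_real.
  by apply: eq_cintegral => w; exact: bphi.
have nE w : normc (b w * phi w) = normc (phi w) ^+ 2.
  by rewrite bphi normcC ger0_norm ?sqr_ge0.
have E : normc (cintegral (Pz \xx Pw) setT (fun p => b p.2 * phi p.2 *
    (k1 (p.1.1, p.2.1) * k2 (p.1.2, p.2.2) - 1))) <= 2^-1 * sqint Pw phi.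
  have -> : sqint Pw phi = \int[Pz \xx Pw]_p normc (b p.2 * phi p.2).
    rewrite (Rintegral_norm_snd Pz bpi).
    by apply: eq_Rintegral => w _; rewrite nE.
  rewrite -RintegralZl//; last exact: cintegrable_norm.
  apply: normc_cintegral_bound; first exact: cintegrable_meas Ei.
    exact: (integrableZl measurableT _ (cintegrable_norm bpW)).
  move=> p; rewrite normcM mulrC ler_wpM2r ?normc_ge0//.
  (* This splitting is bounded by [1/8 * 9/8 + 1/8 = 17/64], below 1/2. *)
  have -> : k1 (p.1.1, p.2.1) * k2 (p.1.2, p.2.2) - 1 =
    (k1 (p.1.1, p.2.1) - 1) * k2 (p.1.2, p.2.2) + (k2 (p.1.2, p.2.2) - 1) by ring.
  apply: le_trans (normcD _ _) _; rewrite normcM.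
  have := k21 (p.1.2, p.2.2).
  have := ler_pM (normc_ge0 _) (normc_ge0 _) (k11 (p.1.1, p.2.1)) (normc_near1 (k21 (p.1.2, p.2.2))).
  lra.
have := cross_bound; set G := cintegral _ _ _ => HG.
have : normc (sqint Pw phi)%:C <= 145 * N * l + 2^-1 * sqint Pw phi.
  rewrite -AE (_ : cintegral _ _ _ = G - cintegral (Pz \xx Pw) setT
    (fun p => b p.2 * phi p.2 * (k1 (p.1.1, p.2.1) * k2 (p.1.2, p.2.2) - 1))).
    by apply: le_trans (normcB _ _) _; apply: lerD.
  have -> : G = cintegral (Pz \xx Pw) setT (fun p => b p.2 * phi p.2) +
    cintegral (Pz \xx Pw) setT
    (fun p => b p.2 * phi p.2 * (k1 (p.1.1, p.2.1) * k2 (p.1.2, p.2.2) - 1)).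
    by rewrite -cintegralD//; apply: eq_cintegral => p; ring.
  by ring.
rewrite normcC ger0_norm ?sqint_ge0//; lra.
Qed.

End test_function.

(** The bound for the truncations does not depend on the height [M], so monotone convergence carries
    it over to [b]; square integrability of [b] is a result here, not an assumption. *)
Lemma square_bound :
  (\int[Pw]_w ((normc (b w) ^+ 2)%:E) <= ((290 * N) ^+ 2)%:E)%E.
Proof.
have mb := cintegrable_meas (bi false false).
pose p (M : nat) w := normc (b w) <= M%:R.
have mp M : measurable_fun setT (p M).
  by apply: measurable_fun_ler; [exact: measurable_normc|exact: measurable_cst].
(* Cutting to 0 above the height [M], rather than capping the modulus, keeps the identity
   [b phi = |phi|^2] exact. *)
pose phi M w : R[i] := if p M w then (b w)^*%C else 0.
have pb M : bmeas (phi M).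
  split; first by apply: cmeasurable_if => //; exact: cmeasurable_conj.
  by exists M%:R => w; rewrite /phi; case: ifPn => [pw|_]; rewrite ?normc_conj ?normc0.
have pE M w : b w * phi M w = (normc (phi M w) ^+ 2)%:C.
  rewrite /phi; case: ifPn => _; first by rewrite mulcJ normc_conj.
  by rewrite mulr0 normc0 expr0n.
have phiM M : sqint Pw (phi M) <= (290 * N) ^+ 2.
  apply: le_sqr_of_le_linear => [||l l0 pl]; first exact: sqint_ge0.
    by rewrite mulr_ge0.
  exact: main_term_bound.
pose g M w := ((normc (phi M w) ^+ 2)%:E : \bar R).
have mg M : measurable_fun setT (g M).
  by apply/measurable_EFinP/measurable_funX/measurable_normc; case: (pb M).
have g0 M w : [set: T1 * T2] w -> (0 <= g M w)%E by rewrite lee_fin sqr_ge0.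
have gnd w : [set: T1 * T2] w -> nondecreasing_seq (g^~ w).
  move=> _ M M' MM'; rewrite lee_fin /phi.
  case: ifPn => [pw|_]; last by rewrite normc0 expr0n sqr_ge0.
  by rewrite ifT// /p (le_trans pw)// ler_nat.
have := cvg_monotone_convergence (mu := Pw) measurableT mg g0 gnd.
rewrite (_ : (fun x => limn (g^~ x)) = (fun w => (normc (b w) ^+ 2)%:E)); last first.
  apply/funext => w; apply: cvg_lim => //; apply: cvg_near_cst.
  near=> M; rewrite /g /phi ifT ?normc_conj// /p.
  near: M; exact: nbhs_infty_ger.
move=> /cvg_lim <- //; apply: lime_le.
  apply: ereal_nondecreasing_is_cvgn => M M' MM'.
  by apply: ge0_le_integral => // w _; [exact: g0|exact: (gnd w I _ _ MM')].
near=> M; rewrite -[leLHS]fineK ?lee_fin; first exact: phiM.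
exact: (integrable_fin_num measurableT (integrable_sq Pw (pb M))).
Unshelve. all: by end_near. Qed.

End square_function.

Lemma cintegrable_double_diff {R : realType} d1 d2 (T1 : measurableType d1)
    (T2 : measurableType d2) (mu : bool -> probability T1 R)
    (nu : bool -> probability T2 R) (b : T1 * T2 -> R[i])
    (k1 : T1 * T1 -> R[i]) (k2 : T2 * T2 -> R[i]) (phi : T1 * T2 -> R[i]) :
  (forall i j, cintegrable (mu i \xx nu j) setT b) ->
  bmeas k1 -> bmeas k2 -> bmeas phi ->
  cintegrable ((mu true \xx nu true) \xx (mu false \xx nu false)) setT
    (fun p => double_diff b p.1 p.2 * k1 (p.1.1, p.2.1) * k2 (p.1.2, p.2.2) *
      phi p.2).
Proof.
move=> bi k1b k2b pb.
have k1P : bmeas (fun p : (T1 * T2) * (T1 * T2) => k1 (p.1.1, p.2.1)).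
  apply: bmeas_comp k1b.
  by apply: measurable_fun_pair; apply: measurableT_comp.
have k2P : bmeas (fun p : (T1 * T2) * (T1 * T2) => k2 (p.1.2, p.2.2)).
  apply: bmeas_comp k2b.
  by apply: measurable_fun_pair; apply: measurableT_comp.
have m4 := mpres_transpose4 (mu true) (nu true) (mu false) (nu false).
have m10 := mpres_comp m4 (mpres_prod (mpres_fst (mu true) (mu false))
  (mpres_snd (nu true) (nu false))).
have m01 := mpres_comp m4 (mpres_prod (mpres_snd (mu true) (mu false))
  (mpres_fst (nu true) (nu false))).
apply: cintegrableM; last exact: bmeas_snd.
apply: cintegrableM => //; apply: cintegrableM => //.
apply: cintegrableD; last exact: (mpres_cintegrable (mpres_snd _ _) (bi _ _)).
apply: cintegrableB; last exact: (mpres_cintegrable m01 (bi _ _)).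
apply: cintegrableB; last exact: (mpres_cintegrable m10 (bi _ _)).
exact: (mpres_cintegrable (mpres_fst _ _) (bi _ _)).
Qed.

(** * Centring [b] over the original rectangle *)

Section rectangular_oscillation.
Context {R : realType} d1 d2 (T1 : measurableType d1) (T2 : measurableType d2).
Variables (mu : bool -> probability T1 R) (nu : bool -> probability T2 R).
Variables (b : T1 * T2 -> R[i]) (k1 : T1 * T1 -> R[i]) (k2 : T2 * T2 -> R[i]).
Variable N : R.
Hypothesis bi : forall i j, cintegrable (mu i \xx nu j) setT b.
Hypotheses (mk1 : cmeasurable setT k1) (k11 : forall z, normc (k1 z - 1) <= 8^-1).
Hypotheses (mk2 : cmeasurable setT k2) (k21 : forall z, normc (k2 z - 1) <= 8^-1).
Hypothesis N0 : 0 <= N.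

Local Notation Pz := (mu true \xx nu true).
Local Notation Pw := (mu false \xx nu false).

Hypothesis H : forall phi psi a e, bmeas phi -> bmeas psi -> 0 < a -> 0 < e ->
  sqint Pw phi <= a ^+ 2 -> sqint Pz psi <= e ^+ 2 ->
  normc (cintegral Pz setT (fun z => cintegral Pw setT (fun w =>
    double_diff b z w * k1 (z.1, w.1) * k2 (z.2, w.2) * phi w) * psi z)) <=
  N * a * e.

(** Integrand of the rectangular BMO norm, considered on all four rectangles with averages taken
    over the original cubes only. It differs from [b] by a function of the first variable plus a
    function of the second, which the double difference annihilates. *)
Definition oscillation (z : T1 * T2) : R[i] :=
  b z - cintegral (mu false) setT (fun s => b (s, z.2))
      - cintegral (nu false) setT (fun t => b (z.1, t)) + cintegral Pw setT b.

Let ddE z w : double_diff oscillation z w = double_diff b z w.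
Proof. by rewrite /double_diff /oscillation /=; ring. Qed.

Let osc_integrable i j : cintegrable (mu i \xx nu j) setT oscillation.
Proof.
apply: cintegrableD; last exact/cintegrable_bmeas/bmeas_cst.
apply: cintegrableB; last first.
  exact: cintegrable_fst (cfubini_integrable (bi i false)).
apply: cintegrableB => //.
exact: cintegrable_snd (cfubini_integrable2 (bi false j)).
Qed.

(** Valid for those [t] whose slice [b(., t)] is integrable, where the integral of the four terms
    can be split. *)
Let osc0l j :
  {ae nu j, forall t, cintegral (mu false) setT (fun s => oscillation (s, t)) = 0}.
Proof.
apply: filterS (ae_cintegrable2 (bi false j)) => t bt.
have ci0 z : cintegrable (mu false) setT (fun=> z) by exact/cintegrable_bmeas/bmeas_cst.
have B1i := cfubini_integrable (bi false false).
rewrite /oscillation /= cintegralD//; last first.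
  by apply: cintegrableB => //; exact: cintegrableB.
rewrite cintegralB//; last exact: cintegrableB.
rewrite cintegralB// !cintegral_prob_cst (cfubini (bi false false)).
by ring.
Qed.

Let osc0r i :
  {ae mu i, forall s, cintegral (nu false) setT (fun t => oscillation (s, t)) = 0}.
Proof.
apply: filterS (ae_cintegrable (bi i false)) => s bs.
have ci0 z : cintegrable (nu false) setT (fun=> z) by exact/cintegrable_bmeas/bmeas_cst.
have B0i := cfubini_integrable2 (bi false false).
rewrite /oscillation /= cintegralD//; last first.
  by apply: cintegrableB => //; exact: cintegrableB.
rewrite cintegralB//; last exact: cintegrableB.
rewrite cintegralB// !cintegral_prob_cst (cfubini2 (bi false false)).
by ring.
Qed.

(** The pointwise kernel formula for the operator produces an iterated integral, over [w] first;
    Fubini turns [H] into the joint form used by the estimates above. *)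
Let Hosc phi psi a e : bmeas phi -> bmeas psi -> 0 < a -> 0 < e ->
  sqint Pw phi <= a ^+ 2 -> sqint Pz psi <= e ^+ 2 ->
  normc (cintegral (Pz \xx Pw) setT (fun p => double_diff oscillation p.1 p.2 *
    k1 (p.1.1, p.2.1) * k2 (p.1.2, p.2.2) * phi p.2 * psi p.1)) <= N * a * e.
Proof.
move=> pb qb a0 e0 pa qe.
have := H pb qb a0 e0 pa qe; apply: le_trans.
rewrite le_eqVlt; apply/orP; left; apply/eqP; congr normc.
have fi := cintegrable_double_diff bi (bmeas_near1 mk1 k11) (bmeas_near1 mk2 k21) pb.
by rewrite -(cfubiniM fi qb); apply: eq_cintegral => p; rewrite ddE.
Qed.

Lemma oscillation_bound :
  (\int[Pw]_w ((normc (oscillation w) ^+ 2)%:E) <= ((290 * N) ^+ 2)%:E)%E.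
Proof.
apply: square_bound (bmeas_near1 mk1 k11) _ (bmeas_near1 mk2 k21) _ _ _ _ => //.
- move=> phi a pb a0 pa.
  have := Hosc pb (bmeas_cst _ 1) a0 ltr01 pa.
  rewrite mulr1 (_ : cintegral _ _ _ = cintegral (Pz \xx Pw) setT
    (fun p => double_diff oscillation p.1 p.2 * k1 (p.1.1, p.2.1) *
      k2 (p.1.2, p.2.2) * phi p.2)); last first.
    by apply: eq_cintegral => p; rewrite mulr1.
  by apply; apply: sqint_le_bound; [exact: bmeas_cst|move=> x; rewrite normc1].
- move=> i j al ga a e ab gb a0 e0 aa ge.
  exact: (tensor_bound osc_integrable mk1 k11 mk2 k21 N0 osc0l osc0r Hosc).
Qed.

End rectangular_oscillation.

(** * Cubes and kernels *)

(* MathComp-Analysis also calls [edist] its extended distance. *)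
Local Notation edist := Defs.edist.

Section euclidean_geometry.
Context {R : realType} (n : nat).
Implicit Types (x y z c : Rn R n) (l : R).

Lemma edistn_ge0 x y : 0 <= edist x y.
Proof. exact: sqrtr_ge0. Qed.

Lemma edist_sqr x y : edist x y ^+ 2 = \sum_(i < n) (tnth x i - tnth y i) ^+ 2.
Proof. by rewrite sqr_sqrtr// sumr_ge0// => i _; exact: sqr_ge0. Qed.

Lemma edistnC x y : edist x y = edist y x.
Proof. by rewrite /edist; congr Num.sqrt; apply: eq_bigr => i _; ring. Qed.

(** Coordinatewise [(p + q)^2 <= 2 p^2 + 2 q^2]. The lost factor is harmless, as distances are only
    compared up to constants, and Minkowski's inequality is avoided. *)
Lemma edist_sqr_triangle x y z :
  edist x z ^+ 2 <= 2 * edist x y ^+ 2 + 2 * edist y z ^+ 2.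
Proof.
rewrite !edist_sqr !mulr_sumr -big_split/=; apply: ler_sum => i _.
rewrite -subr_ge0.
have -> : 2 * (tnth x i - tnth y i) ^+ 2 + 2 * (tnth y i - tnth z i) ^+ 2 -
  (tnth x i - tnth z i) ^+ 2 = (tnth x i - 2 * tnth y i + tnth z i) ^+ 2 by ring.
exact: sqr_ge0.
Qed.

Lemma edist_le_coord x y e : (forall i, `|tnth x i - tnth y i| <= e) ->
  edist x y ^+ 2 <= n%:R * e ^+ 2.
Proof.
move=> xye; rewrite edist_sqr.
have -> : n%:R * e ^+ 2 = \sum_(i < n) e ^+ 2 by rewrite sumr_const card_ord mulr_natl.
apply: ler_sum => i _; rewrite -(real_normK (num_real _)).
by rewrite lerXn2r ?nnegrE// (le_trans _ (xye i)).
Qed.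

Lemma edist_cube c l x y : cube c l x -> cube c l y ->
  edist x y ^+ 2 <= n%:R * l ^+ 2.
Proof.
move=> cx cy; apply: edist_le_coord => i.
by have := cx i; have := cy i; rewrite ler_norml; lra.
Qed.

Lemma cube_corner c l : 0 <= l -> cube c l c.
Proof. by move=> l0 i; rewrite lexx lerDl. Qed.

Lemma measurable_cube c l : measurable (cube c l).
Proof.
have -> : cube c l = \bigcap_(i in [set: 'I_n])
    ((@tnth n R)^~ i @^-1` `[tnth c i, tnth c i + l]%classic).
  apply/seteqP; split => [x cx i _ /=|x cx i].
    by rewrite in_itv/=; exact: cx.
  by have := cx i I; rewrite /= in_itv.
apply: fin_bigcap_measurable => // i _.
rewrite -[X in measurable X]setTI.
by apply: (@measurable_tnth _ (measurableTypeR R) n i) => //; exact: measurable_itv.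
Qed.

End euclidean_geometry.

Lemma leb_cube {R : realType} n (c : Rn R n) l : 0 <= l ->
  leb R n (cube c l) = (l ^+ n)%:E.
Proof.
move=> l0; elim: n c => [c|n IHn c].
  have -> : cube c l = setT by apply/seteqP; split => // x _ [].
  by rewrite /= diracT expr0.
pose c' : Rn R n := [tuple of behead c].
have tc i : tnth c' i = tnth c (lift ord0 i).
  rewrite /c' tnth_behead; congr tnth; apply: val_inj => /=.
  by rewrite inordK ?ltnS ?ltn_ord// /bump leq0n.
transitivity ((lebesgue_measure \x leb R n)%E
  (`[tnth c ord0, tnth c ord0 + l]%classic `*` cube c' l)).
  rewrite /= /leb_step /pushforward; congr ((lebesgue_measure \x leb R n)%E _).
  apply/seteqP; split => -[x v] /=.
    move=> h; split; first by have := h ord0; rewrite /= in_itv.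
    by move=> i; have := h (lift ord0 i); rewrite tc tnthS.
  move=> [h0 h] i; case: (unliftP ord0 i) => [j|] ->.
    by have := h j; rewrite tc tnthS.
  by rewrite /=; move: h0; rewrite in_itv.
have itvl (a : R) : lebesgue_measure `[a, a + l]%classic = l%:E.
  rewrite lebesgue_measure_itv /= lte_fin ltrDl.
  case: ifPn => [_|]; first by rewrite -EFinB addrAC subrr add0r.
  by rewrite -leNgt => l0'; congr EFin; apply/eqP; rewrite eq_le l0 l0'.
apply: etrans (product_measure1E lebesgue_measure (leb R n) _ _) _.
- exact: measurable_itv.
- exact: measurable_cube.
by rewrite exprS EFinM; congr (_ * _)%E; [exact: itvl|exact: IHn].
Qed.

Section kernel.
Context {R : realType} (n : nat).
Variables (K : Rn R n -> Rn R n -> R[i]) (omega : R -> R).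
Hypothesis hK : CZ_kernel omega K.
Implicit Types x y u : Rn R n.

(** The points are moved one at a time, [x] first. The distance [e] after the first move is at least
    [d/2]: this costs [2 ^ n] in the size factor, and [t/2 * d <= t * e] keeps the argument of
    [omega] at most [t] in the second move too. *)
Lemma kernel_near t x u x' u' : 0 < t -> t < 1 / 2 -> 0 < edist x u ->
  edist x x' <= t / 2 * edist x u -> edist u u' <= t / 2 * edist x u ->
  edist x u / 2 <= edist x' u /\
  normc (K x u - K x' u') <= 2 ^+ n.+1 * (edist x u ^+ n)^-1 * omega t.
Proof.
move=> t0 t1 d0 xx' uu'; have [w0 [wmon [_ Kw]]] := hK.
set d := edist x u in d0 xx' uu' *.
have d' : d / 2 <= edist x' u.
  have := edist_sqr_triangle x x' u; rewrite -/d => h.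
  have xx2 : edist x x' ^+ 2 <= (d / 4) ^+ 2.
    rewrite lerXn2r ?nnegrE ?edistn_ge0//; first by rewrite divr_ge0// ltW.
    by apply: (le_trans xx'); nra.
  rewrite -(ler_pXn2r (ltn0Sn 1)) ?nnegrE ?edistn_ge0//; last by rewrite divr_ge0// ltW.
  rewrite expr_div_n in xx2.
  rewrite expr_div_n; have := sqr_ge0 d; lra.
split => //; set e := edist x' u in d'.
have e0 : 0 < e by apply: lt_le_trans d'; rewrite divr_gt0.
have wt s : 0 <= s -> s <= t -> omega s <= omega t.
  by move=> s0 st; apply: wmon => //; lra.
have wt0 : 0 <= omega t by apply: w0; apply/andP; split; lra.
have i1 : normc (K x u - K x' u) <= (d ^+ n)^-1 * omega t.
  have h0 : edist x x' < edist x u / 2 by rewrite -/d; nra.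
  have := Kw _ _ _ h0; rewrite -/d.
  move=> h; apply: le_trans (_ : (d ^+ n)^-1 * omega (edist x x' / d) <= _).
    by apply: le_trans h; rewrite lerDl normc_ge0.
  rewrite ler_wpM2l ?invr_ge0 ?exprn_ge0 ?(ltW d0)//.
  apply: wt; first by rewrite divr_ge0 ?edistn_ge0 ?ltW.
  by rewrite ler_pdivrMr//; nra.
have i2 : normc (K x' u - K x' u') <= (e ^+ n)^-1 * omega t.
  have h0 : edist u u' < edist u x' / 2 by rewrite (edistnC u x') -/e; nra.
  have := Kw _ _ _ h0; rewrite (edistnC u x') -/e.
  move=> h; apply: le_trans (_ : (e ^+ n)^-1 * omega (edist u u' / e) <= _).
    by apply: le_trans h; rewrite lerDr normc_ge0.
  rewrite ler_wpM2l ?invr_ge0 ?exprn_ge0 ?(ltW e0)//.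
  apply: wt; first by rewrite divr_ge0 ?edistn_ge0 ?ltW.
  by rewrite ler_pdivrMr//; nra.
have -> : K x u - K x' u' = (K x u - K x' u) + (K x' u - K x' u') by ring.
apply: le_trans (normcD _ _) _.
have en : (e ^+ n)^-1 <= 2 ^+ n * (d ^+ n)^-1.
  rewrite -[2 ^+ n]invrK -invfM lef_pV2 ?posrE ?exprn_gt0//; last first.
    by rewrite mulr_gt0 ?invr_gt0 ?exprn_gt0.
  by rewrite -exprVn -exprMn lerXn2r ?nnegrE ?(ltW e0) ?mulr_ge0 ?invr_ge0 ?(ltW d0)// mulrC.
have dn : (d ^+ n)^-1 <= 2 ^+ n * (d ^+ n)^-1.
  by rewrite ler_peMl ?invr_ge0 ?exprn_ge0 ?(ltW d0)// exprn_ege1// ler1n.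
have := ler_wpM2r wt0 en; have := ler_wpM2r wt0 dn.
rewrite exprS; lra.
Qed.

End kernel.

Lemma measurable_fun_countable d (T : measurableType d) d' (T' : measurableType d')
    (C : countType) (h : T -> C) (g : C -> T') :
  (forall c, measurable (h @^-1` [set c])) -> measurable_fun setT (fun x => g (h x)).
Proof.
move=> mh _ Y _; rewrite setTI.
have -> : (fun x => g (h x)) @^-1` Y =
    \bigcup_c (if `[< Y (g c) >] then h @^-1` [set c] else set0).
  apply/seteqP; split => [x Yx|x [c _]].
    by exists (h x) => //; rewrite (asboolT Yx).
  by case: asboolP => // Yc /= ->.
apply: countable_bigcupT_measurable; first exact: countableP.
by move=> c; case: ifP.
Qed.

(** * Rounding to a lattice, as a source of measurable approximations *)

Section grid.
Context {R : realType} (n : nat).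
Implicit Types x y u : Rn R n.

Definition grid (j : nat) x : Rn R n :=
  [tuple ((Num.floor (tnth x i * j.+1%:R))%:~R / j.+1%:R : R) | i < n].

Lemma grid_near j x : edist x (grid j x) <= n.+1%:R / j.+1%:R.
Proof.
have J0 : 0 < j.+1%:R :> R by rewrite ltr0n.
rewrite -(ler_pXn2r (ltn0Sn 1)) ?nnegrE ?edistn_ge0 ?divr_ge0//.
apply: (@le_trans _ _ (n%:R * (j.+1%:R^-1) ^+ 2)).
  apply: edist_le_coord => i; rewrite tnth_mktuple.
  have /andP[f1 f2] := floor_itv (tnth x i * j.+1%:R).
  rewrite -[X in `|X - _|](mulfK (lt0r_neq0 J0)) -mulrBl normrM.
  rewrite (gtr0_norm (_ : 0 < j.+1%:R^-1)) ?invr_gt0//.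
  rewrite ler_piMl ?invr_ge0 ?(ltW J0)//.
  by rewrite ger0_norm ?subr_ge0// lerBlDl addrC (le_trans (ltW f2))// rmorphD/= addrC.
rewrite exprMn; apply: ler_wpM2r; first exact: sqr_ge0.
by rewrite -natrX ler_nat (leq_trans (leqnSn n))// -mulnn leq_pmulr.
Qed.

(** [g] is arbitrary: the composition factors through tuples of integers, a countable set, and the
    level sets of the floors are measurable boxes. Measurability of the kernel, which [CZ_kernel]
    does not include, is obtained from this. *)
Lemma measurable_grid2 d (T : measurableType d) j (g : Rn R n * Rn R n -> T) :
  measurable_fun setT (fun z : Rn R n * Rn R n => g (grid j z.1, grid j z.2)).
Proof.
pose fl (x : Rn R n) : n.-tuple int := [tuple Num.floor (tnth x i * j.+1%:R) | i < n].
pose ungrid (c : n.-tuple int) : Rn R n := [tuple ((tnth c i)%:~R / j.+1%:R : R) | i < n].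
have gE x : grid j x = ungrid (fl x).
  by apply: eq_from_tnth => i; rewrite !tnth_mktuple.
have mfl c : measurable (fl @^-1` [set c]).
  have -> : fl @^-1` [set c] = \bigcap_(i in [set: 'I_n])
      ((fun x : Rn R n => tnth x i * j.+1%:R) @^-1`
        `[(tnth c i)%:~R, (tnth c i + 1)%:~R[%classic).
    apply/seteqP; split => [x /= <- i _|x /= cx].
      by rewrite /= in_itv/= tnth_mktuple; exact: floor_itv.
    apply: eq_from_tnth => i; rewrite tnth_mktuple; apply: floor_def.
    by have := cx i I; rewrite /= in_itv.
  apply: fin_bigcap_measurable => // i _.
  rewrite -[X in measurable X]setTI.
  have mt : measurable_fun setT (fun x : Rn R n => tnth x i * j.+1%:R).
    apply: measurable_funM => //.
    exact: (@measurable_tnth _ (measurableTypeR R) n i).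
  by apply: mt => //; exact: measurable_itv.
have -> : (fun z : Rn R n * Rn R n => g (grid j z.1, grid j z.2)) =
    (fun z => (fun c => g (ungrid c.1, ungrid c.2)) (fl z.1, fl z.2)).
  by apply/funext => z; rewrite !gE.
apply: (@measurable_fun_countable _ _ _ _ (n.-tuple int * n.-tuple int)%type
  (fun z => (fl z.1, fl z.2)) (fun c => g (ungrid c.1, ungrid c.2))) => -[c1 c2].
have -> : (fun x : Rn R n * Rn R n => (fl x.1, fl x.2)) @^-1` [set (c1, c2)] =
    (fl @^-1` [set c1]) `*` (fl @^-1` [set c2]).
  by apply/seteqP; split => -[x u] /= [-> ->].
exact: measurableX.
Qed.

End grid.

Section kernel_regularity.
Context {R : realType} (n : nat).
Variables (K : Rn R n -> Rn R n -> R[i]) (omega : R -> R).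
Hypothesis hK : CZ_kernel omega K.
Hypothesis omega0 : omega t @[t --> 0^'+] --> 0.
Implicit Types x y u : Rn R n.

Lemma modulus_small e : 0 < e -> exists t, [/\ 0 < t, t < 1 / 2 & omega t <= e].
Proof.
move=> e0; move/cvgrPdist_le : omega0 => /(_ _ e0) we.
have : \forall t \near 0^'+, [/\ 0 < t, t < 1 / 2 & omega t <= e].
  near=> t; split.
  - by near: t; exact: nbhs_right_gt.
  - by near: t; apply: nbhs_right_lt; lra.
  - have : `|0 - omega t| <= e by near: t.
    by rewrite sub0r normrN; apply: le_trans; exact: ler_norm.
by move/(@filter_ex _ _ _) => [t ht]; exists t.
Unshelve. all: by end_near. Qed.

Lemma kernel_grid_cvg x u : 0 < edist x u -> forall e, 0 < e ->
  exists J, forall j, (J <= j)%N ->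
    normc (K x u - K (grid j x) (grid j u)) <= e.
Proof.
move=> d0 e e0; set c := 2 ^+ n.+1 * (edist x u ^+ n)^-1.
have c0 : 0 < c by rewrite mulr_gt0 ?exprn_gt0 ?invr_gt0 ?exprn_gt0.
have [t [t0 t1 te]] := modulus_small (divr_gt0 e0 c0).
pose J := (Num.truncn (n.+1%:R / (t / 2 * edist x u))).+1.
have td : 0 < t / 2 * edist x u by rewrite mulr_gt0 ?divr_gt0.
exists J => j Jj.
have Jt : n.+1%:R / j.+1%:R <= t / 2 * edist x u.
  rewrite ler_pdivrMr ?ltr0n// mulrC -ler_pdivrMr// ltW//.
  apply: (lt_le_trans (truncnS_gt _)).
  by rewrite ler_nat; apply: (leq_trans Jj).
have [|_] := @kernel_near _ _ K omega hK t x u (grid j x) (grid j u) t0 t1 d0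
  (le_trans (grid_near _ _) Jt).
  exact: (le_trans (grid_near _ _) Jt).
move/le_trans; apply; rewrite -/c mulrC -ler_pdivlMr//.
Qed.

(** Kernel divided by its value at the two corners. The value 1 off the cubes lets [|k - 1| <= 1/8]
    hold at every point; the measures that integrate it are concentrated on the cubes. *)
Definition kernel_ratio (x0 y0 : Rn R n) (l : R) (z : Rn R n * Rn R n) : R[i] :=
  if `[< (cube x0 l `*` cube y0 l) z >] then K z.1 z.2 / K x0 y0 else 1.

(* [K] is continuous off the diagonal, hence a pointwise limit of functions that
   only depend on finitely many integers. *)
Lemma measurable_kernel_ratio x0 y0 l :
  (forall z, (cube x0 l `*` cube y0 l) z -> 0 < edist z.1 z.2) ->
  cmeasurable setT (kernel_ratio x0 y0 l).
Proof.
move=> pd.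
have mp : measurable_fun setT (fun z => `[< (cube x0 l `*` cube y0 l) z >]).
  apply: (measurable_fun_bool true); rewrite setTI.
  have -> : (fun z => `[< (cube x0 l `*` cube y0 l) z >]) @^-1` [set true] =
      cube x0 l `*` cube y0 l.
    by apply/seteqP; split => z /=; [move/asboolP|move=> h; exact/asboolP].
  by apply: measurableX; exact: measurable_cube.
pose h (j : nat) (z : Rn R n * Rn R n) : R[i] :=
  if `[< (cube x0 l `*` cube y0 l) z >] then
    K (grid j z.1) (grid j z.2) / K x0 y0 else 1.
have mh j : cmeasurable setT (h j).
  apply: cmeasurable_if => //.
  by split; [exact: (measurable_grid2 j
    (fun w => complex.Re (K w.1 w.2 / K x0 y0)))|exact: (measurable_grid2 j
    (fun w => complex.Im (K w.1 w.2 / K x0 y0)))].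
have hc z e : 0 < e -> \forall j \near \oo, normc (kernel_ratio x0 y0 l z - h j z) <= e.
  move=> e0; rewrite /kernel_ratio /h; case: asboolP => [hz|_]; last first.
    by near=> j; rewrite subrr normc0 ltW.
  pose c := normc (K x0 y0)^-1 + 1.
  have c0 : 0 < c by rewrite ltr_wpDl ?normc_ge0.
  have [J HJ] := kernel_grid_cvg (pd _ hz) (divr_gt0 e0 c0).
  exists J => // j /= Jj; rewrite -mulrBl normcM.
  have cK : normc (K x0 y0)^-1 <= c by rewrite lerDl.
  apply: le_trans (ler_pM (normc_ge0 _) (normc_ge0 _) (HJ _ Jj) cK) _.
  by rewrite divfK// gt_eqF.
split.
  apply: (@measurable_fun_cvg _ _ _ _ (fun j z => complex.Re (h j z))).
    by move=> j; case: (mh j).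
  move=> z _; apply/cvgrPdist_le => e e0; apply: filterS (hc z e e0) => j.
  by apply: le_trans; apply: le_trans (normr_Re _); case: (kernel_ratio _ _ _ _) (h j z) => ? ? [].
apply: (@measurable_fun_cvg _ _ _ _ (fun j z => complex.Im (h j z))).
  by move=> j; case: (mh j).
move=> z _; apply/cvgrPdist_le => e e0; apply: filterS (hc z e e0) => j.
by apply: le_trans; apply: le_trans (normr_Im _); case: (kernel_ratio _ _ _ _) (h j z) => ? ? [].
Unshelve. all: by end_near. Qed.

Hypothesis nd : nondegenerate_kernel K.

(** Nondegeneracy at radius [A l] gives a corner [x] at distance at least [A l] with
    [|K| >= 1/(c0 (A l)^n)], whence [M = c0 A^n]. For [A] large, the oscillation of [K] over the two
    cubes is a small fraction of this lower bound. *)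
Lemma reflected_cube : exists2 M : R, 0 < M & forall y l, 0 < l ->
  exists x, [/\ K x y != 0, (normc (K x y))^-1 <= M * l ^+ n,
    positive_distance (cube x l) (cube y l),
    cmeasurable setT (kernel_ratio x y l) &
    forall z, normc (kernel_ratio x y l z - 1) <= 8^-1].
Proof.
have [c0 c00 hnd] := nd.
(* By [kernel_near] the oscillation is at most [2^(n+1) (A l)^-n omega(t)]; this threshold for
   [omega(t)] makes it 1/8 of the lower bound [1/(c0 (A l)^n)]. *)
have ep : 0 < (8 * (2 ^+ n.+1 * c0))^-1 by rewrite invr_gt0 !mulr_gt0 ?exprn_gt0.
have [t [t0 t1 te]] := modulus_small ep.
(* The diameter of a cube is at most [(n+1) l], and with this [A] that is [t/2 * A l], a
   displacement allowed by [kernel_near]. *)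
pose A : R := 2 * n.+1%:R / t.
have A0 : 0 < A by rewrite divr_gt0// mulr_gt0// ltr0n.
exists (c0 * A ^+ n); first by rewrite mulr_gt0// exprn_gt0.
move=> y l l0; have r0 : 0 < A * l by rewrite mulr_gt0.
have [x [rd Kr]] := hnd y (A * l) r0; exists x.
have d0 : 0 < edist x y by exact: lt_le_trans rd.
have rn0 : 0 < c0 * (A * l) ^+ n by rewrite mulr_gt0// exprn_gt0.
have K0 : 0 < normc (K x y) by apply: lt_le_trans Kr; rewrite invr_gt0.
have Kn0 : K x y != 0.
  by apply/eqP => Kxy; move: K0; rewrite Kxy normc0 ltxx.
have small c x' : cube c l x' -> edist c x' <= t / 2 * edist x y.
  move=> cx; apply: (@le_trans _ _ (n.+1%:R * l)); last first.
    have -> : n.+1%:R * l = t / 2 * (A * l) by rewrite /A; field; rewrite gt_eqF.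
    by rewrite ler_wpM2l// divr_ge0// ltW.
  rewrite -(ler_pXn2r (ltn0Sn 1)) ?nnegrE ?edistn_ge0 ?mulr_ge0 ?(ltW l0)//.
  apply: le_trans (edist_cube (cube_corner c (ltW l0)) cx) _.
  by rewrite exprMn ler_wpM2r ?sqr_ge0// -natrX ler_nat (leq_trans (leqnSn n))// -mulnn leq_pmulr.
(* With [d = edist x y], the bounds [|z.1 - y| >= d/2] and [|y - z.2| <= d/4] put into the weak
   triangle inequality yield exactly [d/4]. *)
have far z : (cube x l `*` cube y l) z -> edist x y / 4 <= edist z.1 z.2.
  move=> [zx zy]; have [d2 _] := kernel_near hK t0 t1 d0 (small _ _ zx) (small _ _ zy).
  have := edist_sqr_triangle z.1 z.2 y; rewrite (edistnC z.2 y).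
  have := small _ _ zy; have := edistn_ge0 y z.2; move=> e0 e1 e2.
  rewrite -(ler_pXn2r (ltn0Sn 1)) ?nnegrE ?edistn_ge0//; last by rewrite divr_ge0// ltW.
  have h1 : (edist x y / 2) ^+ 2 <= edist z.1 y ^+ 2.
    by rewrite lerXn2r ?nnegrE ?edistn_ge0// divr_ge0// ltW.
  have h2 : edist y z.2 ^+ 2 <= (edist x y / 4) ^+ 2.
    rewrite lerXn2r ?nnegrE ?edistn_ge0//; first by rewrite divr_ge0// ltW.
    by apply: le_trans e1 _; nra.
  rewrite !expr_div_n in h1 h2 *; lra.
split => //.
- rewrite -(invrK (c0 * A ^+ n * l ^+ n)) lef_pV2 ?posrE//; last first.
    by rewrite invr_gt0 !mulr_gt0 ?exprn_gt0.
  by rewrite -mulrA -exprMn.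
- exists (edist x y / 4); first by rewrite divr_gt0.
  by move=> x' y' hx hy; exact: (far (x', y')).
- apply: measurable_kernel_ratio => z /far; apply: lt_le_trans.
  by rewrite divr_gt0.
move=> z; rewrite /kernel_ratio; case: asboolP => [hz|_]; last first.
  by rewrite subrr normc0.
have [zx zy] := hz.
have [_ kn] := kernel_near hK t0 t1 d0 (small _ _ zx) (small _ _ zy).
have -> : K z.1 z.2 / K x y - 1 = - ((K x y - K z.1 z.2) / K x y).
  by field.
rewrite normc_opp normcM normcV ler_pdivrMr//.
apply: le_trans kn _; apply: le_trans (_ : 8^-1 * (c0 * (A * l) ^+ n)^-1 <= _); last first.
  by rewrite ler_wpM2l.
have i1 : (edist x y ^+ n)^-1 <= ((A * l) ^+ n)^-1.
  rewrite lef_pV2 ?posrE ?exprn_gt0//.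
  by rewrite lerXn2r ?nnegrE ?(ltW r0) ?edistn_ge0.
have i2 : 0 <= (edist x y ^+ n)^-1 by rewrite invr_ge0 exprn_ge0// ltW.
have w0 : 0 <= omega t.
  by case: hK => + _; apply; apply/andP; split; lra.
have i3 := ler_pM i2 w0 i1 te.
rewrite -mulrA.
apply: le_trans (ler_wpM2l (exprn_ge0 n.+1 (ler0n R 2)) i3) _.
rewrite le_eqVlt; apply/orP; left; apply/eqP.
by field; rewrite !gt_eqF// exprn_gt0.
Qed.

End kernel_regularity.

(** * The bi-commutator on a pair of rectangles *)

Section normalized_restriction.
Context {R : realType} d (T : measurableType d).

(** Dictionary between averages over cubes and probability measures; the constant is kept explicit
    because it multiplies under products. *)
Definition nrestr (P L : {measure set T -> \bar R}) (D : set T) (k : R) :=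
  [/\ 0 < k, measurable D &
    forall S, measurable S -> P S = (k%:E * L (S `&` D))%E].

Variables (P L : {measure set T -> \bar R}) (D : set T) (k : R).
Hypothesis PL : nrestr P L D k.

Lemma nrestr_ge0_integral (f : T -> \bar R) : measurable_fun setT f ->
  (forall x, 0 <= f x)%E -> (\int[P]_x f x = k%:E * \int[L]_(x in D) f x)%E.
Proof.
have [k0 mD PLE] := PL; move=> mf f0.
have PD : P (~` D) = 0%E.
  by rewrite PLE ?setICl ?measure0 ?mule0//; exact: measurableC.
have -> : (\int[P]_x f x = \int[P]_(x in D) f x)%E.
  rewrite -(setUv D) ge0_integral_setU//=.
  - rewrite [X in (_ + X)%E]null_set_integral ?adde0//; first exact: measurableC.
    by apply: measurable_funS mf.
  - exact: measurableC.
  - by rewrite setUv.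
  - by apply/disj_setPS => x [].
rewrite (@eq_measure_integral _ _ _ _ (mscale (NngNum (ltW k0)) L)); last first.
  by move=> A mA AD; rewrite PLE// /mscale /= setIidl.
by rewrite ge0_integral_mscale//; apply: measurable_funS mf.
Qed.

(** Holds also when the integral diverges: multiplication by [k > 0] preserves infinite values, and
    [fine] sends them to 0 on both sides. This matters for [cavg] of slices of [b], which must be
    matched at every point, whether the slice is integrable or not. *)
Lemma nrestr_integral (f : T -> \bar R) : measurable_fun setT f ->
  fine (\int[P]_x f x)%E = k * fine (\int[L]_(x in D) f x)%E.
Proof.
have [k0 _ _] := PL; move=> mf.
rewrite integralE [X in _ = _ * fine X]integralE.
rewrite !nrestr_ge0_integral//; [|exact: measurable_funeneg|exact: measurable_funepos].
have := integral_ge0 L (D := D) (f := f^\+%E) (fun _ _ => funepos_ge0 _ _).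
have := integral_ge0 L (D := D) (f := f^\-%E) (fun _ _ => funeneg_ge0 _ _).
case: (\int[L]_(x in D) f^\- x)%E => [b||]//= b0;
  case: (\int[L]_(x in D) f^\+ x)%E => [a||]//= a0.
- by rewrite mulrBr.
- by rewrite gt0_muley ?lte_fin//= mulr0.
- by rewrite gt0_muley ?lte_fin//= mulr0.
- by rewrite gt0_muley ?lte_fin//= mulr0.
Qed.

Lemma nrestr_cintegral (f : T -> R[i]) : cmeasurable setT f ->
  cintegral P setT f = k%:C * cintegral L D f.
Proof.
move=> [f1 f2]; rewrite /cintegral /Rintegral.
rewrite !nrestr_integral; [|exact/measurable_EFinP|exact/measurable_EFinP].
by apply/eqP; rewrite eq_complex /= !mul0r subr0 addr0 !eqxx.
Qed.

Lemma nrestr_cintegrable (f : T -> R[i]) : cmeasurable setT f ->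
  cintegrable L D f -> cintegrable P setT f.
Proof.
move=> [f1 f2] [/integrableP[_ i1] /integrableP[_ i2]].
split; apply/integrableP; split; try exact/measurable_EFinP.
  rewrite nrestr_ge0_integral//; last first.
    by apply: measurableT_comp => //; exact/measurable_EFinP.
  by rewrite lte_mul_pinfty// lee_fin ltW//; case: PL.
rewrite nrestr_ge0_integral//; last first.
  by apply: measurableT_comp => //; exact/measurable_EFinP.
by rewrite lte_mul_pinfty// lee_fin ltW//; case: PL.
Qed.

Lemma nrestr_ae (A : T -> Prop) : {ae L, forall x, D x -> A x} ->
  {ae P, forall x, A x}.
Proof.
have [k0 mD PLE] := PL; move=> [N [mN N0 AN]].
exists (N `|` ~` D); split.
- by apply: measurableU => //; exact: measurableC.
- rewrite PLE; last by apply: measurableU => //; exact: measurableC.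
  rewrite setIUl setICl setU0 (_ : L (N `&` D) = 0%E) ?mule0//.
  apply: (@subset_measure0 _ _ _ L _ N) => //; exact: measurableI.
- move=> x /= nA; have [Dx|nDx] := pselect (D x); last by right.
  by left; apply: AN => /= h; exact/nA/h.
Qed.

End normalized_restriction.

Lemma nrestr_prod {R : realType} d1 d2 (X : measurableType d1)
    (Y : measurableType d2) (P : probability X R) (Q : probability Y R)
    (L : {sigma_finite_measure set X -> \bar R})
    (L' : {sigma_finite_measure set Y -> \bar R}) D D' k k' :
  nrestr P L D k -> nrestr Q L' D' k' ->
  nrestr (P \xx Q) (L \x L')%E (D `*` D') (k * k').
Proof.
move=> [k0 mD PL] [k0' mD' QL]; have kk0 : 0 < k * k' by rewrite mulr_gt0.
have mDD : measurable (D `*` D') by exact: measurableX.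
split => // S mS.
pose LL : {measure set (X * Y) -> \bar R} := (L \x L')%E.
apply: (@product_measure_unique _ _ _ _ _ P Q
  (mscale (NngNum (ltW kk0)) (mrestr LL mDD))) => // A B mA mB.
rewrite /= /mscale /= /mrestr -setXI.
apply: etrans (congr1 (mule (k * k')%:E) (product_measure1E L L' _ _)) _.
- exact: measurableI.
- exact: measurableI.
by rewrite EFinM muleACA; congr (_ * _)%E; rewrite ?PL ?QL.
Qed.

Section square_integrals.
Context {R : realType} d (T : measurableType d).

(** Variant with one factor that may be unbounded, later a multiple of [B g]; its square is
    integrable by the extended bound. *)
Lemma cauchy_schwarz_L2 (P : probability T R) (h psi : T -> R[i]) s e :
  cmeasurable setT h -> bmeas psi -> 0 < s -> 0 < e ->
  (\int[P]_x ((normc (h x) ^+ 2)%:E) <= (s ^+ 2)%:E)%E ->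
  sqint P psi <= e ^+ 2 ->
  normc (cintegral P setT (fun x => h x * psi x)) <= s * e.
Proof.
move=> mh pb s0 e0 hs pe.
have hi : P.-integrable setT (EFin \o (fun x => normc (h x) ^+ 2)).
  apply/integrableP; split.
    exact/measurable_EFinP/measurable_funX/measurable_normc.
  under eq_integral => x _ do rewrite /= ger0_norm ?sqr_ge0//.
  by rewrite (le_lt_trans hs)// ltry.
have hR : \int[P]_x (normc (h x) ^+ 2) <= s ^+ 2.
  by rewrite -lee_fin /Rintegral fineK//; exact: integrable_fin_num hi.
have i1 : P.-integrable setT (EFin \o (fun x => e / s / 2 * normc (h x) ^+ 2)).
  exact: (integrableZl measurableT (e / s / 2) hi).
have i2 : P.-integrable setT (EFin \o (fun x => s / e / 2 * normc (psi x) ^+ 2)).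
  exact: (integrableZl measurableT (s / e / 2) (integrable_sq P pb)).
apply: le_trans (normc_cintegral_bound (g := fun x =>
  e / s / 2 * normc (h x) ^+ 2 + s / e / 2 * normc (psi x) ^+ 2) _ _ _) _.
- by apply: cmeasurableM => //; case: pb.
- exact: (integrableD measurableT i1 i2).
- move=> x; rewrite normcM -subr_ge0.
  have -> : e / s / 2 * normc (h x) ^+ 2 + s / e / 2 * normc (psi x) ^+ 2 -
      normc (h x) * normc (psi x) =
      (e * normc (h x) - s * normc (psi x)) ^+ 2 / (s * e * 2).
    by field; rewrite !gt_eqF.
  by rewrite divr_ge0 ?sqr_ge0// ltW// !mulr_gt0.
rewrite RintegralD// RintegralZl// RintegralZl; [|by []|exact: integrable_sq].
rewrite -/(sqint P psi).
have -> : s * e = e / s / 2 * s ^+ 2 + s / e / 2 * e ^+ 2.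
  by field; rewrite !gt_eqF.
by apply: lerD; rewrite ler_wpM2l// ltW// !divr_gt0.
Qed.

Lemma L2norm_le (mu : {measure set T -> \bar R}) (f : T -> R[i]) (c : R) : 0 <= c ->
  (L2norm mu f <= c%:E)%E <->
  (\int[mu]_x ((normc (f x) ^+ 2)%:E) <= (c ^+ 2)%:E)%E.
Proof.
move=> c0; rewrite /L2norm unlock.
under eq_integral => x _ do
  rewrite /= ger0_norm ?normc_ge0// powR_mulrn ?normc_ge0//.
set X := (\int[mu]_x _)%E.
have X0 : (0 <= X)%E by apply: integral_ge0 => x _; rewrite lee_fin sqr_ge0.
have XE : X = ((X `^ 2^-1) `^ 2)%E by rewrite -poweRrM mulVf// poweRe1.
have cE : (c ^+ 2)%:E = (c%:E `^ 2)%E by rewrite poweR_EFin powR_mulrn.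
split => h.
  rewrite XE cE; apply: gt0_ler_poweR => //; rewrite in_itv/= leey andbT//.
  exact: poweR_ge0.
have -> : c%:E = ((c ^+ 2)%:E `^ 2^-1)%E.
  by rewrite cE -poweRrM mulfV// poweRe1// lee_fin.
apply: gt0_ler_poweR => //; rewrite in_itv/= leey andbT//.
by rewrite lee_fin sqr_ge0.
Qed.

Lemma L2norm_zero (mu : {measure set T -> \bar R}) :
  (L2norm mu (fun=> (0 : R[i])%R) <= 0%:E)%E.
Proof.
apply/(L2norm_le _ _ (lexx 0)).
rewrite integral0_eq ?expr0n ?lexx// => x _.
by rewrite normc0 expr0n.
Qed.

End square_integrals.

Section cube_probability.
Context {R : realType} (n : nat) (c : Rn R n) (l : R).

(** [dirac c] is the default of [mnormalize] for a total mass 0 or infinity; it makes [pcube] a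
    probability for every [l]. *)
Definition pcube : probability (Rn R n) R :=
  mnormalize (mrestr (leb R n) (measurable_cube c l)) (dirac c).

Lemma nrestr_pcube : 0 < l -> nrestr pcube (leb R n) (cube c l) (l ^+ n)^-1.
Proof.
move=> l0; have ln : 0 < l ^+ n by rewrite exprn_gt0.
split; [by rewrite invr_gt0|exact: measurable_cube|].
move=> S mS; rewrite /pcube /= /mnormalize /= /mrestr /=.
have E : leb R n (setT `&` cube c l) = (l ^+ n)%:E by rewrite setTI leb_cube// ltW.
by move: E => /= ->; rewrite eqe gt_eqF//= muleC.
Qed.

End cube_probability.

Section bounded_bicommutator.
Context {R : realType} (n m : nat).
Variables (T1 : linear_operator (R := R) n) (T2 : linear_operator (R := R) m).
Variables (K1 : Rn R n -> Rn R n -> R[i]) (K2 : Rn R m -> Rn R m -> R[i]).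
Variables (b : Rn R n * Rn R m -> R[i]).
Variables (B : (Rn R n * Rn R m -> R[i]) -> (Rn R n * Rn R m -> R[i])).
Hypothesis bloc : locally_integrable2 b.
Hypothesis hB : is_bicommutator T1 T2 K1 K2 b B.

Lemma cube_cover k (x : Rn R k) : exists i : nat, forall j, (i <= j)%N ->
  cube [tuple (- j.+1%:R : R) | _ < k] (2 * j.+1%:R) x.
Proof.
exists (Num.truncn (\sum_(i < k) `|tnth x i|)) => j ij i; rewrite tnth_mktuple.
have : `|tnth x i| <= j.+1%:R.
  apply: (@le_trans _ _ (\sum_(i < k) `|tnth x i|)).
    by rewrite (bigD1 i)//= lerDl sumr_ge0.
  by apply/ltW/(lt_le_trans (truncnS_gt _)); rewrite ler_nat.
by rewrite ler_norml => /andP[? ?]; apply/andP; split; lra.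
Qed.

Lemma locally_integrable_measurable : cmeasurable setT b.
Proof.
pose F (j : nat) : set (Rn R n * Rn R m) :=
  cube [tuple (- j.+1%:R : R) | _ < n] (2 * j.+1%:R) `*`
  cube [tuple (- j.+1%:R : R) | _ < m] (2 * j.+1%:R).
have mF j : measurable (F j) by apply: measurableX; exact: measurable_cube.
have FT : setT = \bigcup_j F j.
  apply/esym/seteqP; split => // -[x y] _.
  have [i Hi] := cube_cover x; have [i' Hi'] := cube_cover y.
  exists (maxn i i') => //; split; first by apply: Hi; exact: leq_maxl.
  by apply: Hi'; exact: leq_maxr.
have bF j : cintegrable (leb2 R n m) (F j) b.
  apply: bloc; do 2 eexists; (split; last by reflexivity);
  by rewrite mulr_gt0.
split; rewrite FT; apply/measurable_fun_bigcup => // j.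
  by apply/measurable_EFinP; exact: (measurable_int _ (bF j).1).
by apply/measurable_EFinP; exact: (measurable_int _ (bF j).2).
Qed.

Let mb := locally_integrable_measurable.

(** Links functions of arbitrary norm to the unit ball, over which the operator norm is a
    supremum. *)
Lemma bicommutator_scale f (r : R) : in_L2 (leb2 R n m) f -> r != 0 ->
  {ae leb2 R n m, forall z, B f z = r%:C * B (fun w => (r^-1)%:C * f w) z}.
Proof.
move=> [mf fL] r0; pose g w := (r^-1)%:C * f w; rewrite -/g.
have L0 : in_L2 (leb2 R n m) (fun=> 0 : R[i]).
  split; first exact: cmeasurable_cst.
  exact: le_lt_trans (L2norm_zero _) (ltry _).
have gL : in_L2 (leb2 R n m) g.
  split; first by apply: cmeasurableM => //; exact: cmeasurable_cst.
  have L20 : (0 <= L2norm (leb2 R n m) f)%E by exact: Lnorm_ge0.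
  have fE := ge0_fin_numE L20; rewrite -{}fE in fL.
  apply: (@le_lt_trans _ _ (`|r^-1| * fine (L2norm (leb2 R n m) f))%:E); last exact: ltry.
  have h := (L2norm_le (leb2 R n m) f (fine_ge0 L20)).1; rewrite fineK// lexx in h.
  apply/L2norm_le; first by rewrite mulr_ge0 ?fine_ge0.
  rewrite (eq_integral (fun z => (`|r^-1| ^+ 2)%:E * (normc (f z) ^+ 2)%:E)%E); last first.
    by move=> z _; rewrite /g normcM normcC exprMn EFinM.
  rewrite ge0_integralZl_EFin ?sqr_ge0//.
  - by rewrite exprMn [leRHS]EFinM; apply: lee_wpmul2l; [rewrite lee_fin sqr_ge0|exact: h].
  - by move=> z _; rewrite lee_fin sqr_ge0.
  - exact/measurable_EFinP/measurable_funX/measurable_normc.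
(* Applied to [1 * 0 + 0], linearity reads [B 0 = B 0 + B 0]. *)
have B00 : {ae leb2 R n m, forall z, B (fun=> 0) z = 0}.
  have := bicomm_linear hB 1 L0 L0; apply: filterS => z.
  have -> : (fun w : Rn R n * Rn R m => 1 * (0 : R[i]) + 0) = (fun=> 0).
    by apply/funext => w; rewrite mulr0 addr0.
  by rewrite mul1r => /esym/eqP; rewrite -subr_eq0 addrK => /eqP.
have := bicomm_linear hB r%:C gL L0; apply: filterS2 B00 => z -> .
have -> : (fun w => r%:C * g w + 0) = f.
  apply/funext => w; rewrite addr0 /g mulrA -rmorphM/= divff//.
  by rewrite rmorph1 mul1r.
by rewrite addr0.
Qed.

Variable N : R.
Hypotheses (N0 : 0 < N) (hN : (L2_opnorm B <= N%:E)%E).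

Lemma bicommutator_bound f : in_L2 (leb2 R n m) f ->
  (L2norm (leb2 R n m) f <= 1)%E ->
  (\int[leb2 R n m]_z ((normc (B f z) ^+ 2)%:E) <= (N ^+ 2)%:E)%E.
Proof.
move=> fL f1; apply/L2norm_le; first exact: ltW.
by apply: le_trans hN; apply: ereal_sup_ubound; exists f.
Qed.

Variables (c x : Rn R n) (l M1 : R) (c' x' : Rn R m) (l' M2 : R).
Hypotheses (l0 : 0 < l) (l'0 : 0 < l') (M10 : 0 < M1) (M20 : 0 < M2).
Hypotheses (Kx : K1 x c != 0) (KM1 : (normc (K1 x c))^-1 <= M1 * l ^+ n).
Hypothesis pd1 : positive_distance (cube x l) (cube c l).
Hypotheses (mk1 : cmeasurable setT (kernel_ratio K1 x c l)).
Hypothesis (k11 : forall z, normc (kernel_ratio K1 x c l z - 1) <= 8^-1).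
Hypotheses (Kx' : K2 x' c' != 0) (KM2 : (normc (K2 x' c'))^-1 <= M2 * l' ^+ m).
Hypothesis pd2 : positive_distance (cube x' l') (cube c' l').
Hypotheses (mk2 : cmeasurable setT (kernel_ratio K2 x' c' l')).
Hypothesis (k21 : forall z, normc (kernel_ratio K2 x' c' l' z - 1) <= 8^-1).

Let mu (i : bool) := pcube (if i then x else c) l.
Let nu (j : bool) := pcube (if j then x' else c') l'.
Let k1 := kernel_ratio K1 x c l.
Let k2 := kernel_ratio K2 x' c' l'.
(** Inverse volume, common to the four rectangles because reflected cubes keep the side lengths. *)
Let kappa : R := (l ^+ n)^-1 * (l' ^+ m)^-1.
Let D (i j : bool) := cube (if i then x else c) l `*` cube (if j then x' else c') l'.

Local Notation Pz := (mu true \xx nu true).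
Local Notation Pw := (mu false \xx nu false).
Local Notation L := (leb2 R n m).

Let kappa0 : 0 < kappa.
Proof. by rewrite mulr_gt0 ?invr_gt0 ?exprn_gt0. Qed.

Let nrD i j : nrestr (mu i \xx nu j) L (D i j) kappa.
Proof. by apply: nrestr_prod; exact: nrestr_pcube. Qed.

Let mD i j : measurable (D i j).
Proof. by apply: measurableX; exact: measurable_cube. Qed.

Let bi i j : cintegrable (mu i \xx nu j) setT b.
Proof.
apply: (nrestr_cintegrable (nrD i j)) => //.
apply: bloc; first by exists (if i then x else c), l.
by exists (if j then x' else c'), l'.
Qed.

Section testing.
Variables (phi : Rn R n * Rn R m -> R[i]) (a : R).
Hypotheses (pb : bmeas phi) (a0 : 0 < a) (pa : sqint Pw phi <= a ^+ 2).

Let f w : R[i] := if `[< D false false w >] then phi w else 0.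
(** [a] bounds the norm of [phi] for the probability [Pw]; [r] bounds that of its restriction [f],
    extended by zero, for Lebesgue measure. *)
Let r := a / Num.sqrt kappa.
Let sk0 : 0 < Num.sqrt kappa. Proof. by rewrite sqrtr_gt0. Qed.
Let r0 : 0 < r. Proof. by rewrite divr_gt0. Qed.
Let r2 : r ^+ 2 * kappa = a ^+ 2.
Proof. by rewrite /r expr_div_n sqr_sqrtr ?(ltW kappa0)// divfK// gt_eqF. Qed.

Let mf : cmeasurable setT f.
Proof.
have mp : measurable_fun setT (fun w => `[< D false false w >]).
  apply: (measurable_fun_bool true); rewrite setTI.
  have -> : (fun w => `[< D false false w >]) @^-1` [set true] = D false false.
    by apply/seteqP; split => z /=; [move/asboolP|move=> h; exact/asboolP].
  exact: mD.
by apply: cmeasurable_if => //; case: pb.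
Qed.

Let f_test : rect_test_fun (cube c l) (cube c' l') f.
Proof.
split => //; split; last by move=> z nz; rewrite /f asboolF.
have [_ [M phiM]] := pb; exists (Num.max M 0) => z; rewrite /f.
case: ifP => _; first by rewrite le_max phiM.
by rewrite normc0 le_max lexx orbT.
Qed.

Let f_sq : (\int[L]_z ((normc (f z) ^+ 2)%:E) <= (r ^+ 2)%:E)%E.
Proof.
have h : (\int[Pw]_z ((normc (phi z) ^+ 2)%:E) <= (a ^+ 2)%:E)%E.
  have fin := integrable_fin_num measurableT (integrable_sq Pw pb).
  by rewrite -(fineK fin) lee_fin.
have mphi : measurable_fun setT (fun z => ((normc (phi z) ^+ 2)%:E : \bar R)).
  by apply/measurable_EFinP/measurable_funX/measurable_normc; case: pb.
rewrite (nrestr_ge0_integral (nrD false false) mphi) in h; last first.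
  by move=> z; rewrite lee_fin sqr_ge0.
have -> : (\int[L]_z ((normc (f z) ^+ 2)%:E) =
    \int[L]_(z in D false false) ((normc (phi z) ^+ 2)%:E))%E.
  rewrite [RHS]integral_mkcond; apply: eq_integral => z _.
  rewrite /f patchE; case: asboolP => Dz; first by rewrite mem_set.
  by rewrite memNset// normc0 expr0n.
have -> : r ^+ 2 = kappa^-1 * a ^+ 2 by rewrite -r2 mulrC mulfK// gt_eqF.
by rewrite EFinM lee_pdivlMl.
Qed.

Let g w := (r^-1)%:C * f w.

Let g_sq : in_L2 L g /\ (L2norm L g <= 1)%E.
Proof.
have g1 : (L2norm L g <= 1)%E.
  apply/L2norm_le => //.
  rewrite (eq_integral (fun z => (r^-1 ^+ 2)%:E * (normc (f z) ^+ 2)%:E)%E); last first.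
    move=> z _; rewrite /g normcM normcC exprMn EFinM.
    by rewrite ger0_norm// invr_ge0 ltW.
  rewrite ge0_integralZl_EFin ?sqr_ge0//.
  - apply: le_trans (lee_wpmul2l _ f_sq) _; first by rewrite lee_fin sqr_ge0.
    by rewrite -EFinM -exprMn mulVf ?gt_eqF// expr1n.
  - by move=> z _; rewrite lee_fin sqr_ge0.
  - exact/measurable_EFinP/measurable_funX/measurable_normc.
split => //; split; first by apply: cmeasurableM => //; exact: cmeasurable_cst.
by apply: le_lt_trans g1 _; exact: ltry.
Qed.

Let f_L2 : in_L2 L f.
Proof.
split => //; apply: (@le_lt_trans _ _ r%:E); last exact: ltry.
by apply/L2norm_le => //; exact: ltW.
Qed.

(** Collects the sign of the kernel formula, the corner values of the kernels, the volume factor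
    [kappa] and the rescaling [f = r g]. *)
Let coef : R[i] := - ((K1 x c * K2 x' c')^-1 * (kappa * r)%:C).

Let kernel_formula : {ae Pz, forall z,
  cintegral Pw setT (fun w =>
    double_diff b z w * k1 (z.1, w.1) * k2 (z.2, w.2) * phi w) = coef * B g z}.
Proof.
have ic k (y : Rn R k) s : 0 < s -> is_cube (cube y s) by exists y, s.
have e1 : {ae Pz, forall z, D true true z /\
  B f z = - cintegral L (D false false) (fun w =>
        (b z - b (z.1, w.2) - b (w.1, z.2) + b w) *
        K1 z.1 w.1 * K2 z.2 w.2 * f w)}.
  have := bicomm_kernel hB (ic _ c _ l0) (ic _ c' _ l'0) (ic _ x _ l0) (ic _ x' _ l'0)
    pd1 pd2 f_test.
  move=> h; apply: (nrestr_ae (nrD true true)).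
  by apply: filterS h => z h [zx zy]; split => //; exact: h.
have e2 : {ae Pz, forall z, B f z = r%:C * B g z}.
  apply: (nrestr_ae (nrD true true)).
  by have := bicommutator_scale f_L2 (lt0r_neq0 r0); apply: filterS => z.
have e3 := ae_cintegrable
  (cintegrable_double_diff bi (bmeas_near1 mk1 k11) (bmeas_near1 mk2 k21) pb).
apply: filterS3 e1 e2 e3 => z [[zx zy] ->] Bg /= Fi.
set F := fun w => _ in Fi *; rewrite -[LHS]/(cintegral Pw setT F).
have KK0 : K1 x c * K2 x' c' != 0 by rewrite mulf_neq0.
have : cintegral Pw setT (fun w => K1 x c * K2 x' c' * F w) =
    kappa%:C * (- (r%:C * B g z)).
  rewrite (nrestr_cintegral (nrD false false)); last first.
    by apply: cmeasurableM; [exact: cmeasurable_cst|exact: cintegrable_meas Fi].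
  rewrite -Bg opprK; congr (_ * _); rewrite /cintegral.
  have E w : D false false w -> K1 x c * K2 x' c' * F w =
      (b z - b (z.1, w.2) - b (w.1, z.2) + b w) * K1 z.1 w.1 * K2 z.2 w.2 * f w.
    move=> Dw; rewrite /F /f asboolT// /k1 /k2 /kernel_ratio /=.
    by move: Dw => [wc wc']; rewrite !asboolT// /double_diff; field; rewrite Kx Kx'.
  by congr (_ +i* _); apply: eq_Rintegral => w /set_mem Dw; rewrite E.
rewrite cintegralZl// => h.
have kr : (kappa * r)%:C = kappa%:C * r%:C by exact: rmorphM.
apply: (mulfI KK0); rewrite h /coef kr.
by rewrite mulNr !mulrN !mulrA divff// mul1r.
Qed.

(** The volumes cancel: [M1 l^n M2 l'^m kappa = M1 M2], and [r^2 kappa = a^2]. This is what makes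
    the final constant independent of the rectangle. *)
Let coef_bound : normc coef ^+ 2 * (kappa * N ^+ 2) <= (M1 * M2 * N * a) ^+ 2.
Proof.
have cb : normc coef <= M1 * M2 * r.
  rewrite normc_opp normcM normcV normcM normcC invfM ger0_norm; last first.
    by rewrite mulr_ge0// ltW.
  have n1 : 0 <= (normc (K1 x c))^-1 by rewrite invr_ge0 normc_ge0.
  have n2 : 0 <= (normc (K2 x' c'))^-1 by rewrite invr_ge0 normc_ge0.
  have := ler_pM n1 n2 KM1 KM2.
  have kr : 0 <= kappa * r by rewrite mulr_ge0// ltW.
  move/(ler_wpM2r kr)/le_trans; apply; rewrite le_eqVlt; apply/orP; left; apply/eqP.
  by rewrite /kappa; field; rewrite !gt_eqF ?exprn_gt0.
have -> : (M1 * M2 * N * a) ^+ 2 = (M1 * M2 * r) ^+ 2 * (kappa * N ^+ 2).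
  have E (u v : R) : u ^+ 2 * v = a ^+ 2 ->
      (M1 * M2 * N * a) ^+ 2 = (M1 * M2 * u) ^+ 2 * (v * N ^+ 2).
    by move=> uv; rewrite exprMn -uv; ring.
  exact: E r2.
apply: ler_wpM2r; first exact: mulr_ge0 (ltW kappa0) (sqr_ge0 _).
by rewrite lerXn2r ?nnegrE ?normc_ge0// (le_trans _ cb)// normc_ge0.
Qed.

(** Cauchy-Schwarz over the reflected rectangle, where the inner integral equals [coef * B g]; the
    square integral of [B g] for [Pz] is at most [kappa] times that over the whole space, where the
    operator norm applies. *)
Lemma tested_form_bound psi e : bmeas psi -> 0 < e -> sqint Pz psi <= e ^+ 2 ->
  normc (cintegral Pz setT (fun z => cintegral Pw setT (fun w =>
    double_diff b z w * k1 (z.1, w.1) * k2 (z.2, w.2) * phi w) * psi z)) <=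
  M1 * M2 * N * a * e.
Proof.
move=> qb e0 qe; have [gL g1] := g_sq.
have mBg := bicomm_measurable hB gL.
have mh : cmeasurable setT (fun z => coef * B g z).
  by apply: cmeasurableM => //; exact: cmeasurable_cst.
rewrite (@cintegral_ae _ _ _ Pz _ (fun z => (coef * B g z) * psi z)).
- apply: cauchy_schwarz_L2 => //; first by rewrite !mulr_gt0.
  have mBg2 : measurable_fun setT (fun z => ((normc (B g z) ^+ 2)%:E : \bar R)).
    exact/measurable_EFinP/measurable_funX/measurable_normc.
  rewrite (eq_integral (fun z => (normc coef ^+ 2)%:E * (normc (B g z) ^+ 2)%:E)%E); last first.
    by move=> z _; rewrite normcM exprMn EFinM.
  rewrite ge0_integralZl_EFin ?sqr_ge0//; last by move=> z _; rewrite lee_fin sqr_ge0.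
  rewrite (nrestr_ge0_integral (nrD true true))//; last first.
    by move=> z; rewrite lee_fin sqr_ge0.
  apply: (@le_trans _ _ ((normc coef ^+ 2)%:E * (kappa%:E * (N ^+ 2)%:E))%E).
    apply: lee_wpmul2l; first by rewrite lee_fin sqr_ge0.
    apply: lee_wpmul2l; first by rewrite lee_fin ltW.
    apply: le_trans (bicommutator_bound gL g1).
    apply: ge0_subset_integral => //.
    by move=> z _; rewrite lee_fin sqr_ge0.
  by rewrite -!EFinM lee_fin coef_bound.
- apply: cmeasurableM; last by case: qb.
  exact: cintegrable_meas (cfubini_integrable
    (cintegrable_double_diff bi (bmeas_near1 mk1 k11) (bmeas_near1 mk2 k21) pb)).
- by apply: cmeasurableM => //; case: qb.
- by apply: filterS kernel_formula => z ->.
Qed.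

End testing.

Lemma rect_osc_le :
  (rect_osc b (cube c l) (cube c' l') <= (290 * (M1 * M2 * N))%:E)%E.
Proof.
have N'0 : 0 <= M1 * M2 * N by rewrite !mulr_ge0// ltW.
have ob : (\int[Pw]_w ((normc (oscillation mu nu b w) ^+ 2)%:E) <=
    ((290 * (M1 * M2 * N)) ^+ 2)%:E)%E.
  apply: (oscillation_bound bi mk1 k11 mk2 k21 N'0) => phi psi a e pb qb a0 e0 pa qe.
  exact: tested_form_bound.
have mosc : cmeasurable setT (oscillation mu nu b).
  apply: cmeasurableD; last exact: cmeasurable_cst.
  apply: cmeasurableB.
    apply: cmeasurableB => //.
    exact: cmeasurable_comp measurable_snd
      (cintegrable_meas (cfubini_integrable2 (bi false false))).
  exact: cmeasurable_comp measurable_fst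
    (cintegrable_meas (cfubini_integrable (bi false false))).
rewrite (nrestr_ge0_integral (nrD false false)) in ob; last 2 first.
- exact/measurable_EFinP/measurable_funX/measurable_normc.
- by move=> z; rewrite lee_fin sqr_ge0.
have LD : leb2 R n m (cube c l `*` cube c' l') = (l ^+ n * l' ^+ m)%:E.
  apply: etrans (product_measure1E (leb R n) (leb R m) _ _) _.
  - exact: measurable_cube.
  - exact: measurable_cube.
  by rewrite EFinM; congr (_ * _)%E; apply: leb_cube; exact: ltW.
have kE : (l ^+ n * l' ^+ m)^-1 = kappa by rewrite invfM.
have oscE z : b z - cavg (leb R n) (cube c l) (fun u => b (u, z.2))
     - cavg (leb R m) (cube c' l') (fun v => b (z.1, v))
     + cavg (leb2 R n m) (cube c l `*` cube c' l') b = oscillation mu nu b z.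
  rewrite /oscillation /cavg LD /= kE.
  rewrite !leb_cube ?(ltW l0) ?(ltW l'0)//=.
  rewrite (nrestr_cintegral (nrD false false) mb).
  rewrite (nrestr_cintegral (nrestr_pcube c l0)); last first.
    exact: cmeasurable_comp (pair2_measurable z.2) mb.
  rewrite (nrestr_cintegral (nrestr_pcube c' l'0))//.
  exact: cmeasurable_comp (pair1_measurable z.1) mb.
rewrite /rect_osc LD /= kE.
under eq_integral => z _ do rewrite oscE.
have -> : (290 * (M1 * M2 * N))%:E =
    (((290 * (M1 * M2 * N)) ^+ 2)%:E `^ 2^-1)%E.
  have -> : ((290 * (M1 * M2 * N)) ^+ 2)%:E = ((290 * (M1 * M2 * N))%:E `^ 2)%E.
    by rewrite poweR_EFin powR_mulrn// mulr_ge0.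
  by rewrite -poweRrM mulfV// poweRe1// lee_fin mulr_ge0.
apply: gt0_ler_poweR => //; rewrite in_itv/= leey andbT//.
  apply: mule_ge0; first by rewrite lee_fin ltW.
  by apply: integral_ge0 => z _; rewrite lee_fin sqr_ge0.
by rewrite lee_fin sqr_ge0.
Qed.

End bounded_bicommutator.

(** * Passage from a single rectangle to the supremum *)

Theorem theorem1p3 (R : realType) (n m : nat) (hn : (0 < n)%N) (hm : (0 < m)%N)
    (T1 : linear_operator (R := R) n) (T2 : linear_operator (R := R) m)
    (K1 : Rn R n -> Rn R n -> R[i]) (K2 : Rn R m -> Rn R m -> R[i])
    (hT1 : nondegenerate_CZO T1 K1) (hT2 : nondegenerate_CZO T2 K2) :
  exists2 C : R, 0 < C &
    forall (b : Rn R n * Rn R m -> R[i])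
      (B : (Rn R n * Rn R m -> R[i]) -> (Rn R n * Rn R m -> R[i])),
      locally_integrable2 b ->
      is_bicommutator T1 T2 K1 K2 b B ->
      (L2_opnorm B < +oo)%E ->
      (BMO_rect_norm b < +oo)%E /\
      (BMO_rect_norm b <= C%:E * L2_opnorm B)%E.
Proof.
have [[w1 hK1 w10] [_ nd1]] := hT1; have [[w2 hK2 w20] [_ nd2]] := hT2.
have [M1 M10 HM1] := reflected_cube hK1 w10 nd1.
have [M2 M20 HM2] := reflected_cube hK2 w20 nd2.
pose C := 290 * (M1 * M2); have C0 : 0 < C by rewrite !mulr_gt0.
exists C => // b B bloc hB Bfin.
(* The estimate on a rectangle asks for a positive [N], while the norm may be 0; it is applied with
   [N + 1] for finiteness and with [N + e / C], [e] arbitrary, for the inequality. *)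
have key N : 0 < N -> (L2_opnorm B <= N%:E)%E -> (BMO_rect_norm b <= (C * N)%:E)%E.
  move=> N0 hN; apply: ge_ereal_sup => _ [I [c [l [l0 ->]]]] [J [c' [l' [l'0 ->]]]] <-.
  have [x [Kx KM1 pd1 mk1 k11]] := HM1 c l l0.
  have [x' [Kx' KM2 pd2 mk2 k21]] := HM2 c' l' l'0.
  rewrite /C -!mulrA mulrA.
  have := rect_osc_le bloc hB N0 hN l0 l'0 M10 M20 Kx KM1 pd1 mk1 k11 Kx' KM2 pd2 mk2 k21.
  by rewrite !mulrA.
have B0 : (0 <= L2_opnorm B)%E.
  apply: le_ereal_sup_tmp; exists (L2norm (leb2 R n m) (B (fun=> 0))); last exact: Lnorm_ge0.
  exists (fun=> 0) => //.
  have h := L2norm_zero (leb2 R n m).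
  split; last by apply: (le_trans h); rewrite lee_fin.
  by split; [exact: cmeasurable_cst|apply: (le_lt_trans h); exact: ltry].
have Bn : L2_opnorm B \is a fin_num by rewrite ge0_fin_numE.
set N := fine (L2_opnorm B); have NE : L2_opnorm B = N%:E by rewrite fineK.
have N0 : 0 <= N by exact: fine_ge0.
split.
  have N1 : 0 < N + 1 by rewrite ltr_wpDl.
  apply: le_lt_trans (key _ N1 _) _; last exact: ltry.
  by rewrite NE lee_fin lerDl.
rewrite NE -EFinM; apply/lee_addgt0Pr => e e0.
have N1 : 0 < N + e / C by rewrite ltr_wpDl// divr_gt0.
apply: le_trans (key _ N1 _) _; first by rewrite NE lee_fin lerDl divr_ge0// ltW.
by rewrite -EFinD lee_fin mulrDr mulrCA divff ?mulr1// gt_eqF.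
Qed.
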